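(* Let $l$ be a line on a smooth quartic surface $X \subset \mathbb{P}^3$ over $\mathbb{C}$. Then the following conditions are equivalent: (a) the line $l$ is special; (b) there exists a symplectic symmetry $\sigma\colon X \rightarrow X$ of order $3$ which preserves each plane containing $l$ as a set.
   Context: All varieties are defined over $\mathbb{C}$. A symmetry of a smooth quartic surface $X \subset \mathbb{P}^3$ is an automorphism of $X$ which is the restriction of an automorphism of $\mathbb{P}^3$; the corresponding automorphism of $\mathbb{P}^3$ is denoted by the same letter. A symmetry is symplectic if it acts trivially on $H^{2,0}(X)$. A line $l$ on a smooth quartic $X$ is called special if one can choose homogeneous coordinates $x_0,\ldots,x_3$ of $\mathbb{P}^3$ so that $l$ is given by $x_0 = x_1 = 0$ and $X$ is given by an equation of the form \[ x_0x_3^3 + x_1x_2^3 + x_2x_3\,q(x_0,x_1) + g(x_0,x_1) = 0, \] where $q$ and $g$ are homogeneous polynomials of degree $2$ and $4$, respectively. *)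

(* Defs.v *)
From HB Require Import structures.
From mathcomp Require Import all_boot all_order all_algebra.
From mathcomp Require Import reals complex mpoly.

Set Implicit Arguments.
Unset Strict Implicit.
Unset Printing Implicit Defensive.

Import GRing.Theory.
Local Open Scope ring_scope.
Local Open Scope complex_scope.

(* Projective space P^3 over a field K is handled through homogeneous
   coordinates: a point is a nonzero row vector up to scaling, that is, up to
   equality (_ == _)%MS of row spaces, and a line (resp. plane) is the row space
   of a matrix of rank 2 (resp. 3).  An automorphism of P^3 is the class of an
   invertible matrix A, acting by p |-> p *m A.  The definitions have their usual
   geometric meaning for K algebraically closed of characteristic 0. *)

Section QuarticSurfaces.
Variable K : fieldType.
Implicit Types (F : {mpoly K[4]}) (A M : 'M[K]_4) (L : 'M[K]_(2, 4)).
Implicit Types (p u v : 'rV[K]_4).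

Definition on_surface F p : bool := F.@[p 0] == 0.

(* The punctured affine cone over the surface. *)
Definition on_cone F p : bool := (p != 0) && on_surface F p.

(* Smoothness is the Jacobian criterion; it forces F != 0. *)
Definition smooth_quartic F : Prop :=
  F \is 4.-homog /\
  forall p, on_cone F p -> exists i, F^`M(i).@[p 0] != 0.

Definition line_on_surface F L : Prop :=
  \rank L = 2%N /\ forall p, (p <= L)%MS -> on_surface F p.

Definition linear_coordinate M (j : 'I_4) : {mpoly K[4]} :=
  \sum_(i < 4) M i j *: 'X_i.

Definition special_form (x : 'I_4 -> {mpoly K[4]}) (q g : {mpoly K[2]}) :
    {mpoly K[4]} :=
  let x0 := x (inord 0) in let x1 := x (inord 1) in
  let x2 := x (inord 2) in let x3 := x (inord 3) in
  x0 * x3 ^+ 3 + x1 * x2 ^+ 3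
  + x2 * x3 * (q \mPo [tuple x0; x1]) + (g \mPo [tuple x0; x1]).

(* The new coordinates of p are the entries of p *m M.  The equation of a
   quartic surface is determined up to a nonzero factor, here c. *)
Definition special_line F L : Prop :=
  exists M (q g : {mpoly K[2]}) (c : K),
    [/\ M \in unitmx, q \is 2.-homog, g \is 4.-homog & c != 0] /\
    (forall p, (p <= L)%MS =
       ((p *m M) 0 (inord 0) == 0) && ((p *m M) 0 (inord 1) == 0)) /\
    F = c *: special_form (linear_coordinate M) q g.

Definition symmetry F A : Prop :=
  A \in unitmx /\ forall p, on_surface F (p *m A) = on_surface F p.

Definition trivial_on_surface F A : Prop :=
  forall p, on_cone F p -> (p *m A == p)%MS.

(* Order as an automorphism of the surface. *)
Definition symmetry_order F A (n : nat) : Prop :=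
  [/\ (0 < n)%N, trivial_on_surface F (A ^+ n) &
      forall m, (0 < m < n)%N -> ~ trivial_on_surface F (A ^+ m)].

Definition preserves_planes_through L A : Prop :=
  forall P : 'M[K]_(3, 4),
    \rank P = 3%N -> (L <= P)%MS -> (P *m A == P)%MS.

(* Tangent space at p of the punctured affine cone Y. *)
Definition cone_tangent F p u : bool :=
  \sum_(i < 4) F^`M(i).@[p 0] * u 0 i == 0.

(* H^{2,0}(X) = H^0(X, Omega^2_X) for a smooth quartic X = {F = 0}.  The
   projection pi : Y -> X is a principal bundle for the multiplicative group,
   so pi^* identifies the 2-forms on X with the 2-forms w on Y that are
   horizontal (killed by the Euler field, whose value at p is p) and invariant
   under scaling.  As Y is closed in the punctured affine space, a 2-form on Y
   is regular iff Zariski-locally it is the restriction of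
   h^-1 * \sum_(i, j) B_ij dx_i (x) dx_j with polynomial B_ij and h.
   Only the values w p u v with p in Y and u, v tangent to Y at p matter. *)
Definition regular_2form F (w : 'rV[K]_4 -> 'rV[K]_4 -> 'rV[K]_4 -> K) : Prop :=
  [/\ forall p u, on_cone F p -> cone_tangent F p u -> w p u u = 0,
      forall p u, on_cone F p -> cone_tangent F p u -> w p p u = 0,
      forall (c : K) p u v, c != 0 -> on_cone F p ->
        cone_tangent F p u -> cone_tangent F p v ->
        w (c *: p) (c *: u) (c *: v) = w p u v
    & forall p0, on_cone F p0 ->
        exists (B : 'I_4 -> 'I_4 -> {mpoly K[4]}) (h : {mpoly K[4]}),
          h.@[p0 0] != 0 /\
          forall p u v, on_cone F p -> h.@[p 0] != 0 ->
            cone_tangent F p u -> cone_tangent F p v ->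
            w p u v =
              (\sum_(i < 4) \sum_(j < 4) (B i j).@[p 0] * u 0 i * v 0 j)
              / h.@[p 0]].

(* The pullback of w by A is (p, u, v) |-> w (p *m A) (u *m A) (v *m A); by
   scaling invariance it depends only on the class of A. *)
Definition symplectic F A : Prop :=
  forall w, regular_2form F w ->
  forall p u v, on_cone F p -> cone_tangent F p u -> cone_tangent F p v ->
    w (p *m A) (u *m A) (v *m A) = w p u v.

End QuarticSurfaces.

(* Main.v *)
Require Import Defs.
From mathcomp Require Import all_boot all_order all_algebra.
From mathcomp Require Import reals complex mpoly.
From mathcomp Require Import ring.
From mathcomp Require boolp.

(** Choose coordinates in which the line is [x0 = x1 = 0], and let [z] be a
primitive cube root of unity.

If the surface is given by the special form, then multiplying [x2] by [z] and
[x3] by [z ^+ 2] preserves the equation and every plane through the line, and has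
determinant 1. To see that it is symplectic, consider the residue of the volume
form along the cone over the surface, [residue], which has no zeros and is
preserved. A regular 2-form is the product of the residue and a regular function
on the surface ([regular_2form_multiple]), so it remains to prove that regular
functions are constant. On the line this is elementary. The other points are on
the plane cubics that are residual to the line in the planes through it. A plane
cubic is projected to the projective line from a point of the line, and the
product over the fibres of the values of a regular function is again a function
without poles, hence constant ([rational_constant], [cubic_norm]). As one fibre
lies on the line, where the function is already known to be constant, the function
takes no other value on the cubic ([plane_cubic_constant]).

Conversely, let [A] be a symplectic symmetry of order 3 that preserves the planes
through the line. Testing its action on the residue shows that the derivative of
the equation [F] at a point of the cone is multiplied by the determinant of [A]
when the point and the direction are moved by [A] ([symplectic_dform]). The matrix
acts as a scalar modulo the line, and may be normalized to act trivially. On the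
line its cube is a scalar, so that it is diagonalizable. At the points of the line
the derivative of [F] is a pair of binary cubic forms without common zeros; their
behaviour under [A] forces the eigenvalues on the line to be [z] and [z ^+ 2]
([line_eigenvalues]) and the binary cubics to be spanned by [x2 ^+ 3] and
[x3 ^+ 3] ([dform_fixed]). Hence there are coordinates in which [A] is diagonal and
the part of [F] that is linear in [x0] and [x1] is [x0 * x3 ^+ 3 + x1 * x2 ^+ 3]
([fixed_dual_basis]). The monomials of the special form are the invariant ones
among those that remain. The others do not occur: in a general plane through the
line, the lines that pass through a fixed point of the given line and are close to
it meet the residual cubic in three distinct points; on such a line, the
difference of the equation and its image under [A], divided by the square of the
equation of the given line, has degree at most 2 and vanishes at these points
([symmetric_cubic_coefs]). *)

Set Implicit Arguments.
Unset Strict Implicit.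
Unset Printing Implicit Defensive.

Import GRing.Theory Num.Theory.
Local Open Scope ring_scope.
Local Open Scope complex_scope.

(** * Polynomials as functions over an infinite field *)

Section PolynomialFunctions.
Variable K : numFieldType.

Lemma poly_nonroot (P : {poly K}) : P != 0 -> exists x, P.[x] != 0.
Proof.
move=> P_neq0; pose s : seq K := [seq i%:R | i <- iota 0 (size P)].
have s_uniq : uniq s.
  by rewrite map_inj_uniq ?iota_uniq // => i j /eqP; rewrite eqr_nat => /eqP.
have /allPn[x _ Px] : ~~ all (root P) s.
  apply/negP => sP; have := max_poly_roots P_neq0 sP s_uniq.
  by rewrite size_map size_iota ltnn.
by exists x.
Qed.

Lemma poly_eval_inj (P Q : {poly K}) : (forall x, P.[x] = Q.[x]) -> P = Q.
Proof.
move=> PQ; apply/eqP; rewrite -subr_eq0; apply/negPn/negP => /poly_nonroot[x].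
by rewrite hornerD hornerN PQ subrr eqxx.
Qed.

Lemma mpoly_generated_ind (n : nat) (P : {mpoly K[n]} -> Prop) :
  (forall c, P c%:MP) -> (forall i, P 'X_i) ->
  (forall p q, P p -> P q -> P (p + q)) ->
  (forall p q, P p -> P q -> P (p * q)) -> forall p, P p.
Proof.
move=> PC PX PD PM; elim/mpolyind => [|c m p _ _ Pp]; first exact: (PC 0).
apply: PD => //; rewrite -mul_mpolyC; apply: (PM) => //.
rewrite mpolyXE_id; elim/big_rec: _ => [|i q _ Pq]; first exact: (PC 1).
apply: (PM) => //; elim: (m i) => [|k Pk]; first exact: (PC 1).
by rewrite exprS; apply: PM.
Qed.

(** The first order Taylor expansion, which determines the derivatives of [F] from
its values on lines. *)
Lemma line_poly (n : nat) (p u : 'I_n -> K) (F : {mpoly K[n]}) :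
  exists Q : {poly K}, (forall s, Q.[s] = F.@[fun i => p i + s * u i]) /\
    Q`_1 = \sum_(i < n) F^`M(i).@[p] * u i.
Proof.
elim/mpoly_generated_ind: F => [c|i|F G [P [PE P1]] [Q [QE Q1]]
                               |F G [P [PE P1]] [Q [QE Q1]]].
- exists c%:P; split=> [s|]; first by rewrite hornerC mevalC.
  by rewrite coefC /= big1 // => i _; rewrite mderivC meval0 mul0r.
- exists ((p i)%:P + u i *: 'X); split=> [s|].
    by rewrite !hornerE mevalXU mulrC.
  rewrite coefD coefC coefZ coefX /= add0r mulr1 (bigD1 i) //= big1 ?addr0.
    rewrite mderivX mnm1E eqxx scale1r.
    by rewrite -[X in (X - _)%MM]add0m addmK mpolyX0 meval1 mul1r.
  move=> j ji; rewrite mderivX mnm1E eq_sym (negPf ji) scale0r meval0.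
  by rewrite mul0r.
- exists (P + Q); split=> [s|]; first by rewrite hornerD mevalD PE QE.
  rewrite coefD P1 Q1 -big_split /=; apply: eq_bigr => i _.
  by rewrite mderivD mevalD mulrDl.
- exists (P * Q); split=> [s|]; first by rewrite hornerM mevalM PE QE.
  have p0 : (fun i => p i + 0 * u i) =1 p by move=> i; rewrite mul0r addr0.
  rewrite coefM !big_ord_recl big_ord0 addr0 /= -!horner_coef0 PE QE P1 Q1.
  rewrite !(meval_eq _ p0) mulr_sumr mulr_suml -big_split /=.
  apply: eq_bigr => i _; rewrite mderivM mevalD !mevalM; ring.
Qed.

Lemma meval0_mcoeff (n : nat) (F : {mpoly K[n]}) : F.@[fun=> 0] = F@_0%MM.
Proof.
elim/mpoly_generated_ind: F => [c|i|F G FE GE|F G FE GE].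
- by rewrite mevalC mcoeffC eqxx mulr1.
- by rewrite mevalXU mcoeffX mnm1_eq0.
- by rewrite mevalD FE GE mcoeffD.
- by rewrite mevalM FE GE rmorphM.
Qed.

(** All the derivatives of a polynomial function that is zero vanish, and in
characteristic zero they determine the coefficients. *)
Lemma mpoly_eval_eq0 (n : nat) (F : {mpoly K[n]}) :
  (forall v, F.@[v] = 0) -> F = 0.
Proof.
move=> F0; apply/mpolyP => m; rewrite mcoeff0.
have [d] := ubnP (mdeg m); elim: d => // d IHd in m F F0 *; rewrite ltnS => md.
have [->|m0] := eqVneq m 0%MM; first by rewrite -meval0_mcoeff.
have [i mi] : exists i, m i != 0%N.
  apply/existsP; rewrite -negb_forall; apply: contraNN m0 => /forallP m0.
  by apply/eqP/mnmP => i; rewrite mnm0E; apply/eqP.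
have mE : m = (m - U_(i) + U_(i))%MM by rewrite submK // lep1mP.
have dF0 v : F^`M(i).@[v] = 0.
  have [Q [QE Q1]] := line_poly v (fun j => (j == i)%:R) F.
  have Q0 : Q = 0 by apply: poly_eval_inj => s; rewrite QE F0 horner0.
  move: Q1; rewrite Q0 coef0 (bigD1 i) //= eqxx mulr1 big1 ?addr0 // => j ji.
  by rewrite (negPf ji) mulr0.
have /eqP : F^`M(i)@_(m - U_(i))%MM = 0.
  by apply: IHd => //; rewrite mE mdegD mdeg1 addn1 in md.
by rewrite mcoeff_deriv -mE mulrn_eq0 => /eqP.
Qed.

Lemma mpoly_eval_inj (n : nat) (F G : {mpoly K[n]}) :
  (forall v, F.@[v] = G.@[v]) -> F = G.
Proof.
move=> FG; apply/eqP; rewrite -subr_eq0; apply/eqP/mpoly_eval_eq0 => v.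
by rewrite mevalB FG subrr.
Qed.

End PolynomialFunctions.

(** * Homogeneous polynomials *)

Section HomogeneousPolynomials.
Variable K : numFieldType.

Lemma dhomog_eval (n d : nat) (F : {mpoly K[n]}) (c : K) (v : 'I_n -> K) :
  F \is d.-homog -> F.@[fun i => c * v i] = c ^+ d * F.@[v].
Proof.
move=> /dhomogP homF; rewrite !mevalE mulr_sumr !big_seq; apply: eq_bigr => m mF.
rewrite -(homF m mF) mulrCA; congr (_ * _).
under eq_bigr do rewrite exprMn.
by rewrite big_split /= prodrXr -mdegE.
Qed.

Lemma dhomog_comp (n k d : nat) (lq : n.-tuple {mpoly K[k]}) (F : {mpoly K[n]}) :
  (forall i, tnth lq i \is 1.-homog) -> F \is d.-homog ->
  F \mPo lq \is d.-homog.
Proof.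
move=> hom1 /dhomogP homF; rewrite comp_mpolyEX big_seq rpred_sum // => m mF.
have <- : mdeg m = d := homF m mF.
rewrite rpredZ // comp_mpolyX mdegE.
elim/big_rec2: _ => [|i e q _ homq]; first exact: dhomog1.
by apply: dhomogM => //; have := dhomogMn (m i) (hom1 i); rewrite mul1n.
Qed.

Definition point2 (x0 x1 : K) : 'I_2 -> K := tnth [tuple x0; x1].

Lemma dhomog_eval2 (d : nat) (G : {mpoly K[2]}) (c x0 x1 : K) :
  G \is d.-homog -> G.@[point2 (c * x0) (c * x1)] = c ^+ d * G.@[point2 x0 x1].
Proof.
move=> /dhomog_eval <-; apply: meval_eq => i.
by case: i => [[|[|//]] ?]; rewrite /point2 !(tnth_nth 0).
Qed.

(** The monomials are collected by their exponents in the last two coordinates.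
The vectors [e0], ..., [e3] need not be independent: they will also be used to
restrict [F] to a plane. *)
Lemma quartic_decomposition (F : {mpoly K[4]}) (e0 e1 e2 e3 : 'rV[K]_4) :
  F \is 4.-homog ->
  exists G : nat -> nat -> {mpoly K[2]},
    [/\ forall i j, (i + j <= 4)%N -> G i j \is (4 - (i + j)).-homog,
        forall i j, (4 < i + j)%N -> G i j = 0
      & forall x0 x1 x2 x3,
        F.@[(x0 *: e0 + x1 *: e1 + x2 *: e2 + x3 *: e3) 0] =
        \sum_(i < 5) \sum_(j < 5) (G i j).@[point2 x0 x1] * x2 ^+ i * x3 ^+ j].
Proof.
move=> homF; pose e := [tuple e0; e1; e2; e3].
pose lq := [tuple \sum_(k < 4) tnth e k 0 i *: ('X_k : {mpoly K[4]}) | i < 4].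
have homF' : F \mPo lq \is 4.-homog.
  apply: dhomog_comp => // i; rewrite tnth_mktuple rpred_sum // => k _.
  by rewrite rpredZ // dhomogX /= mdeg1.
set F' := F \mPo lq in homF'.
pose k0 : 'I_4 := inord 0; pose k1 : 'I_4 := inord 1.
pose k2 : 'I_4 := inord 2; pose k3 : 'I_4 := inord 3.
have degE (m : 'X_{1..4}) : mdeg m = (m k0 + m k1 + (m k2 + m k3))%N.
  rewrite mdegE !big_ord_recl big_ord0 addn0 !addnA.
  by congr (_ + _ + _ + _)%N; congr (m _); apply: val_inj; rewrite /= ?inordK.
have X_hom (k : 'I_2) i : ('X_k : {mpoly K[2]}) ^+ i \is i.-homog.
  have homX : ('X_k : {mpoly K[2]}) \is 1.-homog by rewrite dhomogX /= mdeg1.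
  by have := dhomogMn i homX; rewrite mul1n.
pose G i j : {mpoly K[2]} := \sum_(m <- msupp F' | (m k2 == i) && (m k3 == j))
   F'@_m *: ('X_0 ^+ m k0 * 'X_1 ^+ m k1).
have mdeg4 m : m \in msupp F' -> (m k0 + m k1 + (m k2 + m k3))%N = 4%N.
  by rewrite -degE; move/dhomogP: homF'; apply.
exists G; split=> [i j ij|i j ij|x0 x1 x2 x3].
- rewrite /G big_seq_cond rpred_sum // => m /and3P[/mdeg4 md /eqP <- /eqP <-].
  by rewrite rpredZ // (canLR (addnK _) (esym md)); apply: dhomogM.
- rewrite /G big_seq_cond big1 // => m /and3P[/mdeg4 md /eqP mi /eqP mj].
  by have := leq_addl (m k0 + m k1) (m k2 + m k3); rewrite md mi mj leqNgt ij.
pose x := [tuple x0; x1; x2; x3].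
transitivity (F'.@[tnth x]).
  rewrite comp_mpoly_meval; apply: meval_eq => i.
  rewrite tnth_mktuple raddf_sum /=; under eq_bigr do rewrite mevalZ mevalXU.
  rewrite !big_ord_recl big_ord0 addr0 !mxE /e /x !(tnth_nth 0) /=; ring.
rewrite mevalE; transitivity (\sum_(m <- msupp F')
    \sum_(i < 5) \sum_(j < 5) (if (m k2 == i) && (m k3 == j) then
      F'@_m * (x0 ^+ m k0 * x1 ^+ m k1) * x2 ^+ i * x3 ^+ j else 0)).
  rewrite !big_seq; apply: eq_bigr => m /mdeg4 md.
  have m2 : (m k2 < 5)%N by rewrite ltnS (leq_trans _ (eq_leq md)) // addnCA leq_addr.
  have m3 : (m k3 < 5)%N by rewrite ltnS (leq_trans _ (eq_leq md)) // addnA leq_addl.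
  rewrite (bigD1 (Ordinal m2)) //= [X in _ + X]big1 ?addr0; last first.
    by move=> i; rewrite -val_eqE /= eq_sym => /negPf mi; rewrite big1 // => j _; rewrite mi.
  rewrite (bigD1 (Ordinal m3)) //= [X in _ + X]big1 ?addr0; last first.
    by move=> j; rewrite -val_eqE /= eq_sym => /negPf mj; rewrite mj andbF.
  rewrite !eqxx /= -!mulrA; congr (_ * _).
  rewrite !big_ord_recl big_ord0 mulr1 /x !(tnth_nth 0) /=.
  by do !congr (_ * _); congr (_ ^+ m _); apply: val_inj; rewrite /= ?inordK.
rewrite exchange_big; apply: eq_bigr => i _.
rewrite exchange_big; apply: eq_bigr => j _.
rewrite /G raddf_sum /= !mulr_suml -big_mkcond; apply: eq_bigr => m /= _.
by rewrite mevalZ mevalM !rmorphXn /= !mevalXU /point2 !(tnth_nth 0).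
Qed.

End HomogeneousPolynomials.

(** * The volume of four vectors *)

Section Volume.
Variable K : fieldType.

Definition vol (n p u v : 'rV[K]_4) : K :=
  \det (\matrix_(i < 4) tnth [tuple n; p; u; v] i).

Lemma vol_mulmx (A : 'M[K]_4) n p u v :
  vol (n *m A) (p *m A) (u *m A) (v *m A) = vol n p u v * \det A.
Proof.
rewrite /vol -det_mulmx; congr (\det _); apply/row_matrixP => i.
rewrite row_mul !rowK.
by case: i => [[|[|[|[|//]]]] ?]; rewrite !(tnth_nth 0).
Qed.

Lemma vol_linear_n a b n n' p u v :
  vol (a *: n + b *: n') p u v = a * vol n p u v + b * vol n' p u v.
Proof.
apply: (@determinant_multilinear _ _ _ _ _ ord0); rewrite ?rowK ?(tnth_nth 0) //.
all: apply/matrixP => i j; rewrite !mxE !(tnth_nth 0).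
all: by case: i => [[|[|[|//]]] ?].
Qed.

Lemma vol_linear_p a b n p p' u v :
  vol n (a *: p + b *: p') u v = a * vol n p u v + b * vol n p' u v.
Proof.
apply: (@determinant_multilinear _ _ _ _ _ (inord 1));
  rewrite ?rowK ?(tnth_nth 0) ?inordK //.
all: apply/matrixP => i j; rewrite !mxE !(tnth_nth 0).
all: by case: i => [[|[|[|//]]] ?]; rewrite /= inordK.
Qed.

Lemma vol_linear_u a b n p u u' v :
  vol n p (a *: u + b *: u') v = a * vol n p u v + b * vol n p u' v.
Proof.
apply: (@determinant_multilinear _ _ _ _ _ (inord 2));
  rewrite ?rowK ?(tnth_nth 0) ?inordK //.
all: apply/matrixP => i j; rewrite !mxE !(tnth_nth 0).
all: by case: i => [[|[|[|//]]] ?]; rewrite /= inordK.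
Qed.

Lemma vol_linear_v a b n p u v v' :
  vol n p u (a *: v + b *: v') = a * vol n p u v + b * vol n p u v'.
Proof.
apply: (@determinant_multilinear _ _ _ _ _ (inord 3));
  rewrite ?rowK ?(tnth_nth 0) ?inordK //.
all: apply/matrixP => i j; rewrite !mxE !(tnth_nth 0).
all: by case: i => [[|[|[|//]]] ?]; rewrite /= inordK.
Qed.

Lemma vol_alt_nu n p v : vol n p n v = 0.
Proof.
apply: (@determinant_alternate _ _ _ (inord 0) (inord 2)).
  by rewrite -val_eqE /= !inordK.
by move=> j; rewrite !mxE !(tnth_nth 0) !inordK.
Qed.

Lemma vol_alt_nv n p u : vol n p u n = 0.
Proof.
apply: (@determinant_alternate _ _ _ (inord 0) (inord 3)).
  by rewrite -val_eqE /= !inordK.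
by move=> j; rewrite !mxE !(tnth_nth 0) !inordK.
Qed.

Lemma vol_alt_pu n p v : vol n p p v = 0.
Proof.
apply: (@determinant_alternate _ _ _ (inord 1) (inord 2)).
  by rewrite -val_eqE /= !inordK.
by move=> j; rewrite !mxE !(tnth_nth 0) !inordK.
Qed.

Lemma vol_alt_uv n p u : vol n p u u = 0.
Proof.
apply: (@determinant_alternate _ _ _ (inord 2) (inord 3)).
  by rewrite -val_eqE /= !inordK.
by move=> j; rewrite !mxE !(tnth_nth 0) !inordK.
Qed.

Lemma vol_alt_pv n p u : vol n p u p = 0.
Proof.
apply: (@determinant_alternate _ _ _ (inord 1) (inord 3)).
  by rewrite -val_eqE /= !inordK.
by move=> j; rewrite !mxE !(tnth_nth 0) !inordK.
Qed.

Lemma vol_swap_uv n p u v : vol n p v u = - vol n p u v.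
Proof.
apply/eqP; rewrite -addr_eq0; apply/eqP.
have := vol_alt_uv n p (1 *: u + 1 *: v).
rewrite vol_linear_u !vol_linear_v !vol_alt_uv => <-; ring.
Qed.

Lemma volZ c n p u v : vol n (c *: p) (c *: u) (c *: v) = c ^+ 3 * vol n p u v.
Proof.
rewrite -[c *: p]addr0 -(scale0r p) vol_linear_p -[c *: u]addr0 -(scale0r u).
rewrite !vol_linear_u -[c *: v]addr0 -(scale0r v) !vol_linear_v; ring.
Qed.

(** The covector [c] makes the matrix of the four vectors singular. *)
Lemma vol_hyperplane (c : 'cV[K]_4) n p u v : c != 0 ->
  n *m c = 0 -> p *m c = 0 -> u *m c = 0 -> v *m c = 0 -> vol n p u v = 0.
Proof.
move=> c_neq0 nc pc uc vc; set M := \matrix_(i < 4) tnth [tuple n; p; u; v] i.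
have Mc : M *m c = 0.
  apply/row_matrixP => i; rewrite row_mul rowK row0.
  by case: i => [[|[|[|[|//]]]] ?]; rewrite !(tnth_nth 0).
apply: contraNeq c_neq0 => volN0; have Mu : M \in unitmx by rewrite unitmxE unitfE.
by rewrite -[c](mulKmx Mu) Mc mulmx0.
Qed.

Lemma vol_col_mx n p u v :
  vol n p u v = \det (col_mx (col_mx n p) (col_mx u v) : 'M_4).
Proof.
congr (\det _); apply/matrixP => i j; rewrite !mxE (tnth_nth 0).
case: splitP => k ->; rewrite !mxE; case: splitP => l kl; rewrite kl (ord1 l) //.
Qed.

Lemma extend_free_rows (m n : nat) (A : 'M[K]_(m, m + n)) : row_free A ->
  exists B : 'M[K]_(n, m + n), (col_mx A B : 'M_(m + n)) \in unitmx.
Proof.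
move=> /eqP rankA; exists (dsubmx (row_ebase A)).
have -> : col_mx A (dsubmx (row_ebase A)) =
    block_mx (col_ebase A) 0 0 1%:M *m row_ebase A.
  rewrite -{2}[row_ebase A]vsubmxK mul_block_col !mul0mx mul1mx add0r addr0.
  congr (col_mx _ _); rewrite -{1}[A]mulmx_ebase rankA pid_mx_row -mulmxA.
  by rewrite -{1}[row_ebase A]vsubmxK mul_row_col mul0mx mul1mx addr0.
rewrite unitmx_mul row_ebase_unit andbT unitmxE det_ublock det1 mulr1 -unitmxE.
exact: col_ebase_unit.
Qed.

Lemma rank_pair (m : nat) (n p : 'rV[K]_m) : p != 0 -> ~~ (n <= p)%MS ->
  \rank (n + p)%MS = 2%N.
Proof.
move=> p0 np; have rp : \rank p = 1%N by rewrite rank_rV p0.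
have le2 : (\rank (n + p)%MS <= 1 + 1)%N.
  by rewrite (leq_trans (mxrank_adds_leqif n p)) ?leq_add ?rank_leq_row.
apply/eqP; rewrite eqn_leq le2 /=.
have := np; rewrite ltnNge; apply: contraNN => le1.
have : (p == n + p)%MS by rewrite -(geq_leqif (mxrank_leqif_eq (addsmxSr n p))) rp.
by move=> /andP[_]; apply: submx_trans; apply: addsmxSl.
Qed.

Lemma vol_neq0_extension (n p : 'rV[K]_4) : p != 0 -> ~~ (n <= p)%MS ->
  exists u v, vol n p u v != 0.
Proof.
move=> p0 np; have np_free : row_free (col_mx n p).
  by rewrite /row_free -addsmxE rank_pair.
have [B] := @extend_free_rows 2 2 _ np_free; rewrite unitmxE unitfE => detN0.
exists (usubmx (B : 'M_(1 + 1, _))), (dsubmx (B : 'M_(1 + 1, _))).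
by rewrite vol_col_mx vsubmxK.
Qed.

End Volume.

(** * The residue 2-form *)

Section Residue.
Variable K : numFieldType.
Implicit Types (F : {mpoly K[4]}) (A : 'M[K]_4) (n p u v : 'rV[K]_4).

Lemma linear_sum_delta (g : 'rV[K]_4 -> K) u :
  (forall a b x y, g (a *: x + b *: y) = a * g x + b * g y) ->
  g u = \sum_(i < 4) u 0 i * g (delta_mx 0 i).
Proof.
move=> g_lin; have g0 : g 0 = 0.
  by have := g_lin 0 0 0 0; rewrite !scale0r addr0 !mul0r addr0.
rewrite {1}[u]row_sum_delta; elim/big_rec2: _ => // i c x _ <-.
by rewrite -[x in LHS]scale1r g_lin mul1r.
Qed.

(** The derivative of [F] at [p] in the direction [u]. *)
Definition dform F p u : K := \sum_(i < 4) F^`M(i).@[p 0] * u 0 i.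

Lemma cone_tangentE F p u : cone_tangent F p u = (dform F p u == 0).
Proof. by []. Qed.

Lemma dform_linear F p a b u v :
  dform F p (a *: u + b *: v) = a * dform F p u + b * dform F p v.
Proof.
rewrite /dform !mulr_sumr -big_split; apply: eq_bigr => i _ /=.
by rewrite !mxE; ring.
Qed.

Lemma dform_delta F p i : dform F p (delta_mx 0 i) = F^`M(i).@[p 0].
Proof.
rewrite /dform (bigD1 i) //= big1 ?addr0 => [|j ji]; first by rewrite mxE !eqxx mulr1.
by rewrite mxE eqxx (negPf ji) mulr0.
Qed.

Lemma line_poly4 F p u : exists Q : {poly K},
  (forall s, Q.[s] = F.@[(p + s *: u) 0]) /\ Q`_1 = dform F p u.
Proof.
have [Q [QE Q1]] := line_poly (p 0) (u 0) F; exists Q; split=> // s.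
by rewrite QE; apply: meval_eq => i; rewrite !mxE.
Qed.

(** Derivatives are computed below by expanding [F] along lines, which replaces
the chain rule for linear changes of coordinates. *)
Lemma dform_unique F p u (Q : {poly K}) :
  (forall s, Q.[s] = F.@[(p + s *: u) 0]) -> dform F p u = Q`_1.
Proof.
move=> QE; have [P [PE <-]] := line_poly4 F p u.
by have -> : P = Q by apply: poly_eval_inj => s; rewrite PE QE.
Qed.

Lemma quarticZ F c p : F \is 4.-homog -> F.@[(c *: p) 0] = c ^+ 4 * F.@[p 0].
Proof. by move=> /dhomog_eval <-; apply: meval_eq => i; rewrite mxE. Qed.

Lemma dform_invariant F A p u :
  (forall x : 'rV_4, F.@[(x *m A) 0] = F.@[x 0]) ->
  dform F (p *m A) (u *m A) = dform F p u.
Proof.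
move=> FA; have [Q [QE <-]] := line_poly4 F p u; apply: dform_unique => s.
by rewrite scalemxAl -mulmxDl FA QE.
Qed.

Lemma dformZZ F c p u : F \is 4.-homog ->
  dform F (c *: p) (c *: u) = c ^+ 4 * dform F p u.
Proof.
move=> homF; have [Q [QE <-]] := line_poly4 F p u.
rewrite -coefZ; apply: dform_unique => s.
by rewrite hornerZ QE -quarticZ // scalerDr !scalerA [c * s]mulrC.
Qed.

Lemma dformZ F c p u : F \is 4.-homog ->
  dform F (c *: p) u * c = c ^+ 4 * dform F p u.
Proof.
move=> homF; rewrite -dformZZ // -[c *: u]addr0 -(scale0r u) dform_linear.
by rewrite mul0r addr0 mulrC.
Qed.

(** Euler's relation on the cone: [F] vanishes along the line through [0] and
[p]. *)
Lemma dform_radial F p : F \is 4.-homog -> on_surface F p -> dform F p p = 0.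
Proof.
move=> homF /eqP Fp; rewrite (@dform_unique _ _ _ 0) ?coef0 // => s.
by rewrite -[p in p + _]scale1r -scalerDl quarticZ // Fp mulr0 horner0.
Qed.

Lemma smooth_dform F p : smooth_quartic F -> on_cone F p ->
  exists n, dform F p n != 0.
Proof.
by move=> [_ smF] /smF[i Fi]; exists (delta_mx 0 i); rewrite dform_delta.
Qed.

(** A combination of [m] and [n] is tangent to the cone, and four vectors of a
hyperplane have volume zero. *)
Lemma vol_dform F m n p u v : F \is 4.-homog -> on_surface F p ->
  cone_tangent F p u -> cone_tangent F p v ->
  vol m p u v * dform F p n = vol n p u v * dform F p m.
Proof.
move=> homF Fp Tu Tv; pose c : 'cV[K]_4 := \col_i F^`M(i).@[p 0].
have cE x : x *m c = (dform F p x)%:M.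
  rewrite [x *m c]mx11_scalar mxE; congr _%:M; apply: eq_bigr => i _.
  by rewrite mxE mulrC.
have [c0|c_neq0] := eqVneq c 0.
  have d0 x : dform F p x = 0.
    by have := congr1 (fun B : 'M_1 => B 0 0) (cE x); rewrite c0 mulmx0 !mxE eqxx.
  by rewrite !d0 !mulr0.
have /eqP : vol (dform F p n *: m + - dform F p m *: n) p u v = 0.
  apply: (vol_hyperplane c_neq0); rewrite cE.
  - by rewrite dform_linear mulNr mulrC subrr raddf0.
  - by rewrite dform_radial // raddf0.
  - by rewrite (eqP (Tu : dform F p u == 0)) raddf0.
  - by rewrite (eqP (Tv : dform F p v == 0)) raddf0.
by rewrite vol_linear_n mulNr subr_eq0 mulrC [in X in _ == X]mulrC => /eqP.
Qed.

(** The residue along the cone of the volume form of the ambient space, contracted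
with the Euler field: a 2-form of the surface without zeros. By [vol_dform] any
vector transverse to the cone can take the place of the chosen basis vector. *)
Definition residue F p u v : K :=
  if [pick i | F^`M(i).@[p 0] != 0] is Some i
  then vol (delta_mx 0 i) p u v / F^`M(i).@[p 0] else 0.

Lemma residueP F n p u v : F \is 4.-homog -> on_surface F p ->
  (exists i, F^`M(i).@[p 0] != 0) ->
  cone_tangent F p u -> cone_tangent F p v ->
  vol n p u v = residue F p u v * dform F p n.
Proof.
move=> homF Fp [i Fi] Tu Tv; rewrite /residue.
case: pickP => [j Fj|/(_ i)]; last by rewrite Fi.
by rewrite mulrAC (vol_dform _ n) // dform_delta mulfK.
Qed.

Lemma residueE F n p u v : F \is 4.-homog -> on_surface F p ->
  cone_tangent F p u -> cone_tangent F p v -> dform F p n != 0 ->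
  residue F p u v = vol n p u v / dform F p n.
Proof.
move=> homF Fp Tu Tv n_neq0; apply: (mulIf n_neq0).
rewrite divfK // -residueP //; apply/existsP; apply: contraNT n_neq0.
rewrite negb_exists => /forallP F0; rewrite /dform big1 // => i _.
by move: (F0 i); rewrite negbK => /eqP ->; rewrite mul0r.
Qed.

(** The value of a regular 2-form is only prescribed on tangent vectors, and it is
useful to have one that vanishes on the others. *)
Definition tangent_residue F p u v : K :=
  if cone_tangent F p u && cone_tangent F p v then residue F p u v else 0.

Lemma cone_tangentZ F c p u : F \is 4.-homog -> c != 0 ->
  cone_tangent F (c *: p) (c *: u) = cone_tangent F p u.
Proof.
by move=> homF c0; rewrite !cone_tangentE dformZZ // mulf_eq0 expf_eq0 (negPf c0).
Qed.

(** Where a partial derivative of [F] is nonzero, it is the denominator of the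
residue, and the numerator is a volume, which is linear in the point. *)
Lemma regular_tangent_residue F : smooth_quartic F ->
  regular_2form F (tangent_residue F).
Proof.
move=> smF; have [homF smF'] := smF; rewrite /tangent_residue; split.
- move=> p u Yp Tu; rewrite Tu; have [n dn] := smooth_dform smF Yp.
  have /andP[_ Fp] := Yp.
  by rewrite (residueE (n := n)) // vol_alt_uv mul0r.
- move=> p u Yp Tu; have [n dn] := smooth_dform smF Yp; have /andP[_ Fp] := Yp.
  have Tp : cone_tangent F p p by rewrite cone_tangentE dform_radial.
  by rewrite Tp Tu (residueE (n := n)) // vol_alt_pu mul0r.
- move=> c p u v c0 Yp Tu Tv; have [n dn] := smooth_dform smF Yp.
  have /andP[_ Fp] := Yp; rewrite !cone_tangentZ // Tu Tv.
  have Fcp : on_surface F (c *: p) by rewrite /on_surface quarticZ // (eqP Fp) mulr0.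
  have dcn := dformZ c p n homF.
  have dcn0 : dform F (c *: p) n != 0.
    apply: contraNneq (mulf_neq0 (expf_neq0 4 c0) dn) => dcn0.
    by rewrite -dcn dcn0 mul0r.
  rewrite (residueE (n := n)) ?cone_tangentZ // volZ [RHS](residueE (n := n)) //.
  have -> : dform F (c *: p) n = c ^+ 3 * dform F p n.
    by apply: (mulIf c0); rewrite dcn; ring.
  by rewrite -mulf_div divff ?expf_neq0 // mul1r.
move=> p0 Yp0; have [k Fk] := smF' p0 Yp0.
pose e (i : 'I_4) : 'rV[K]_4 := delta_mx 0 i.
exists (fun i j => \sum_(l < 4) vol (e k) (e l) (e i) (e j) *: 'X_l), F^`M(k).
split=> // p u v Yp Fkp Tu Tv; rewrite Tu Tv; have /andP[_ Fp] := Yp.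
rewrite (residueE (n := e k)) ?dform_delta //; congr (_ / _).
rewrite (linear_sum_delta u (fun a b x y => vol_linear_u a b (e k) p x y v)).
apply: eq_bigr => i _.
rewrite (linear_sum_delta v (fun a b x y => vol_linear_v a b (e k) p (e i) x y)).
rewrite mulr_sumr; apply: eq_bigr => j _.
rewrite (linear_sum_delta p (fun a b x y => vol_linear_p a b (e k) x y (e i) (e j))).
rewrite mulrA [LHS]mulrC -[RHS]mulrA; congr (_ * _); rewrite raddf_sum /=.
by apply: eq_bigr => l _; rewrite mevalZ mevalXU mulrC.
Qed.

(** The projection of [x] to the tangent space along [n], multiplied by the
derivative in the direction [n] to make it polynomial in [p]. *)
Definition tangent_part F p n x := dform F p n *: x + - dform F p x *: n.

Lemma cone_tangent_part F p n x : cone_tangent F p (tangent_part F p n x).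
Proof. by rewrite cone_tangentE dform_linear mulNr mulrC subrr. Qed.

Lemma vol_tangent_part F p n u v :
  vol n p (tangent_part F p n u) (tangent_part F p n v) =
  dform F p n ^+ 2 * vol n p u v.
Proof.
rewrite /tangent_part vol_linear_u !vol_linear_v !vol_alt_nu !vol_alt_nv; ring.
Qed.

Lemma transverse_frame F p : smooth_quartic F -> on_cone F p ->
  exists n u v, dform F p n != 0 /\ vol n p u v != 0.
Proof.
move=> smF Yp; have /andP[p0 Fp] := Yp; have [n dn] := smooth_dform smF Yp.
have np : ~~ (n <= p)%MS.
  apply: contraNN dn => /sub_rVP[a ->].
  have dp : dform F p p = 0 by apply: dform_radial => //; have [] := smF.
  by rewrite -[a *: p]addr0 -(scale0r p) dform_linear dp !mulr0 addr0.
by have [u [v vol0]] := vol_neq0_extension p0 np; exists n, u, v.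
Qed.

(** As [tangent_residue] is zero on vectors that are not tangent, its invariance
forces a symplectic [A] to map tangent vectors to tangent vectors. The volume,
which is multiplied by the determinant, is the product of the residue, which is
invariant, and the derivative. *)
Lemma symplectic_dform F A p n : smooth_quartic F -> symmetry F A ->
  symplectic F A -> on_cone F p ->
  dform F (p *m A) (n *m A) = \det A * dform F p n.
Proof.
move=> smF [Au FA] sympA Yp; have [homF _] := smF.
have /andP[p0 Fp] := Yp; have [m [u0 [v0 [dm vol0]]]] := transverse_frame smF Yp.
have FpA : on_surface F (p *m A) by rewrite FA.
have YpA : on_cone F (p *m A).
  rewrite /on_cone FpA andbT; apply: contra_neq p0 => pA0.
  by rewrite -[p](mulmxK Au) pA0 mul0mx.
have vol_uv := vol_tangent_part F p m u0 v0.
set u := tangent_part F p m u0 in vol_uv; set v := tangent_part F p m v0 in vol_uv.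
have [Tu Tv] : cone_tangent F p u /\ cone_tangent F p v.
  by split; apply: cone_tangent_part.
have res0 : residue F p u v != 0.
  rewrite (residueE (n := m)) // vol_uv.
  by rewrite !(mulf_neq0, invr_eq0, expf_neq0).
have := sympA _ (regular_tangent_residue smF) p u v Yp Tu Tv.
rewrite /tangent_residue Tu Tv /=; case: ifP => [/andP[TuA TvA] resA|_ res].
  apply: (mulfI res0); rewrite -{1}resA.
  have [k dk] := smooth_dform smF YpA; have [l dl] := smooth_dform smF Yp.
  rewrite -residueP //; last by have [_] := smF; apply.
  rewrite vol_mulmx (residueP (F := F)) //; last by have [_] := smF; apply.
  ring.
by move: res0; rewrite -res eqxx.
Qed.

End Residue.

(** * Cubics in one variable *)

Section Cubics.
Variable K : numClosedFieldType.

Lemma cubic_split (a b c d : K) : a != 0 -> exists r1 r2 r3,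
  [/\ b = - a * (r1 + r2 + r3), c = a * (r1 * r2 + r1 * r3 + r2 * r3)
    & d = - a * (r1 * r2 * r3)].
Proof.
move=> a0; pose P := Poly [:: d; c; b; a].
have PE : P = [:: d; c; b; a] :> seq K by rewrite (PolyK (c := 0)).
have [rs] := closed_field_poly_normal P.
have -> : lead_coef P = a by rewrite /lead_coef PE.
move=> PE'; have : size P = size (a *: \prod_(z <- rs) ('X - z%:P)) by rewrite -PE'.
rewrite PE size_scale // size_prod_XsubC /=.
case: rs PE' => [|r1 [|r2 [|r3 [|//]]]] // PE' _; exists r1, r2, r3.
have PE3 : P = Poly [:: - a * (r1 * r2 * r3);
    a * (r1 * r2 + r1 * r3 + r2 * r3); - a * (r1 + r2 + r3); a].
  apply: poly_eval_inj => x; rewrite PE' !big_cons big_nil.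
  by rewrite horner_Poly /= !hornerE /=; ring.
by move: PE; rewrite PE3 (PolyK (c := 0)) // => -[<- <- <-].
Qed.

Definition cubic_discriminant (R : comRingType) (a b c d : R) : R :=
  b ^+ 2 * c ^+ 2 - 4 * a * c ^+ 3 - 4 * b ^+ 3 * d
  - 27 * a ^+ 2 * d ^+ 2 + 18 * a * b * c * d.

Lemma quadratic_eq0 (a b c r1 r2 r3 : K) : r1 != r2 -> r1 != r3 -> r2 != r3 ->
  (forall r, r \in [:: r1; r2; r3] -> a + b * r + c * r ^+ 2 = 0) ->
  [/\ a = 0, b = 0 & c = 0].
Proof.
move=> r12 r13 r23 abc; pose P := Poly [:: a; b; c].
have P0 : P = 0.
  apply: (@roots_geq_poly_eq0 _ _ [:: r1; r2; r3]).
  - apply/allP => r /abc rE; rewrite /root horner_Poly /=.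
    by apply/eqP; rewrite -[RHS]rE; ring.
  - by rewrite /= !inE negb_or r12 r13 r23.
  - exact: size_Poly.
by split; [have := coef_Poly [:: a; b; c] 0 | have := coef_Poly [:: a; b; c] 1
  | have := coef_Poly [:: a; b; c] 2]; rewrite -/P P0 coef0.
Qed.

(** The discriminant being nonzero, the cubic has three distinct roots. *)
Lemma quadratic_vanishing_on_cubic (A B C D a b c : K) :
  A != 0 -> cubic_discriminant A B C D != 0 ->
  (forall y, A * y ^+ 3 + B * y ^+ 2 + C * y + D = 0 ->
     a + b * y + c * y ^+ 2 = 0) ->
  [/\ a = 0, b = 0 & c = 0].
Proof.
move=> A0 disc0 abc; have [r1 [r2 [r3 [BE CE DE]]]] := cubic_split B C D A0.
have discE : cubic_discriminant A B C D =
    A ^+ 4 * ((r1 - r2) * (r1 - r3) * (r2 - r3)) ^+ 2.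
  by rewrite BE CE DE /cubic_discriminant; ring.
move: disc0; rewrite discE !(mulf_eq0, expf_eq0) /= !subr_eq0 !negb_or.
move=> /and3P[_ /andP[/andP[r12 r13] r23] _]; apply: (quadratic_eq0 r12 r13 r23) => r.
by rewrite !inE => /or3P[] /eqP ->; apply: abc; rewrite BE CE DE; ring.
Qed.

(** This excludes the monomials outside of the special form: [c30], ..., [c00]
will be the coefficients of a quartic in a plane through the line, and [z] acts
on the plane by a symmetry. The discriminant of the cubic in [y] takes the value
[- 27 * c03 ^+ 2 * c30 ^+ 2] at [s = 0], hence is nonzero for almost all [s]. For
these, the difference of the two cubics is quadratic in [y] and vanishes at three
distinct points, so it is zero. *)
Lemma symmetric_cubic_coefs (z c30 c03 c20 c11 c02 c10 c01 c00 : K) :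
  z ^+ 3 = 1 -> z != 1 -> c30 != 0 -> c03 != 0 ->
  (forall s y : K, s != 0 ->
    c30 + c03 * y ^+ 3 + s * (c20 + c11 * y + c02 * y ^+ 2)
      + s ^+ 2 * (c10 + c01 * y) + s ^+ 3 * c00 = 0 ->
    c30 + c03 * y ^+ 3 + s * (z ^+ 2 * c20 + c11 * y + z * c02 * y ^+ 2)
      + s ^+ 2 * (z * c10 + z ^+ 2 * c01 * y) + s ^+ 3 * c00 = 0) ->
  [/\ c20 = 0, c02 = 0, c10 = 0 & c01 = 0].
Proof.
move=> z3 z1 c30_neq0 c03_neq0 sym.
pose B : {poly K} := c02 *: 'X.
pose C : {poly K} := c11 *: 'X + c01 *: 'X^2.
pose D : {poly K} := c30%:P + c20 *: 'X + c10 *: 'X^2 + c00 *: 'X^3.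
pose Disc := cubic_discriminant c03%:P B C D.
have hornerDisc s : Disc.[s] = cubic_discriminant c03 B.[s] C.[s] D.[s].
  by rewrite /Disc /cubic_discriminant !(hornerE, hornerMn) /=; ring.
have Disc_neq0 : Disc != 0.
  have : Disc.[0] != 0.
    have -> : Disc.[0] = - 27%:R * c03 ^+ 2 * c30 ^+ 2.
      by rewrite hornerDisc /cubic_discriminant /B /C /D !hornerE /=; ring.
    by rewrite !mulf_neq0 ?expf_neq0 // oppr_eq0 pnatr_eq0.
  by apply: contra_neq => Disc0; rewrite Disc0 horner0.
have z2_neq1 : z ^+ 2 - 1 != 0.
  rewrite subr_eq0; apply: contra_neq z1 => z2.
  by rewrite -z3 exprS z2 mulr1.
have z1' : z - 1 != 0 by rewrite subr_eq0.
have good s : s != 0 -> Disc.[s] != 0 ->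
    [/\ c02 = 0, c01 = 0 & (z + 1) * c20 + s * c10 = 0].
  move=> s0; rewrite hornerDisc => disc0.
  have [E1 E2 E3] : [/\ (z ^+ 2 - 1) * c20 + s * ((z - 1) * c10) = 0,
      s * ((z ^+ 2 - 1) * c01) = 0 & (z - 1) * c02 = 0].
    apply: (quadratic_vanishing_on_cubic c03_neq0 disc0) => y yE.
    have yE' : c30 + c03 * y ^+ 3 + s * (c20 + c11 * y + c02 * y ^+ 2)
      + s ^+ 2 * (c10 + c01 * y) + s ^+ 3 * c00 = 0.
      by rewrite -[RHS]yE /B /C /D !hornerE /=; ring.
    have E := sym s y s0 yE'; apply: (mulfI s0).
    rewrite mulr0 -[RHS](subrr 0) -{1}E -yE'; ring.
  split.
  - by move/eqP: E3; rewrite mulf_eq0 (negPf z1') /= => /eqP.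
  - by move/eqP: E2; rewrite !mulf_eq0 (negPf s0) (negPf z2_neq1) /= => /eqP.
  - by apply: (mulfI z1'); rewrite mulr0 -E1; ring.
(* The relation between [c20] and [c10] is needed for two values of [s]. *)
have [s1] : exists s, ('X * Disc).[s] != 0.
  by apply: poly_nonroot; rewrite mulf_neq0 ?polyX_eq0.
rewrite hornerM hornerX mulf_eq0 negb_or => /andP[s1_neq0 disc1].
have [s2] : exists s, ('X * ('X - s1%:P) * Disc).[s] != 0.
  by apply: poly_nonroot; rewrite !mulf_neq0 ?polyX_eq0 ?polyXsubC_eq0.
rewrite !hornerM hornerX hornerXsubC !mulf_eq0 !negb_or.
move=> /andP[/andP[s2_neq0 s21] disc2].
have [c02_0 c01_0 E1] := good s1 s1_neq0 disc1.
have [_ _ E2] := good s2 s2_neq0 disc2.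
have c10_0 : c10 = 0.
  apply: (mulfI s21); rewrite mulr0 -[RHS](subrr 0) -{1}E2 -E1; ring.
split=> //; move/eqP: E1; rewrite c10_0 mulr0 addr0 mulf_eq0 => /orP[|/eqP//].
move=> z1E; case/eqP: z2_neq1.
have -> : z ^+ 2 - 1 = (z - 1) * (z + 1) by ring.
by rewrite (eqP z1E) mulr0.
Qed.

End Cubics.

(** * Plane sections through a line *)

Section PlaneSections.
Variable K : numClosedFieldType.
Implicit Types (F : {mpoly K[4]}) (p u v e : 'rV[K]_4).

Definition cubic_part (c : nat -> nat -> K) x y : K :=
  c 3%N 0%N * x ^+ 3 + c 2%N 1%N * x ^+ 2 * y
  + c 1%N 2%N * x * y ^+ 2 + c 0%N 3%N * y ^+ 3.

(** The equation of a plane quartic curve that contains the line [s = 0], with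
[c i j] the coefficient of the monomial of degrees [i] and [j] in [x] and [y]. *)
Definition quartic_section (c : nat -> nat -> K) s x y : K :=
  s * cubic_part c x y
  + s ^+ 2 * (c 2%N 0%N * x ^+ 2 + c 1%N 1%N * x * y + c 0%N 2%N * y ^+ 2)
  + s ^+ 3 * (c 1%N 0%N * x + c 0%N 1%N * y) + s ^+ 4 * c 0%N 0%N.

(** The planes through the line spanned by [v2] and [v3] are parametrized by the
direction [e]. The coefficients of the plane sections are homogeneous polynomials
in the parameters; those of degree zero vanish as the line lies on the surface. *)
Lemma section_through_line F e0 e1 v2 v3 : F \is 4.-homog ->
  (forall x y, F.@[(x *: v2 + y *: v3) 0] = 0) ->
  exists G : nat -> nat -> {mpoly K[2]},
    (forall i j, (i + j <= 4)%N -> G i j \is (4 - (i + j)).-homog) /\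
    forall t0 t1, let c i j := (G i j).@[point2 t0 t1] in
    let e := t0 *: e0 + t1 *: e1 in
    (forall s x y, F.@[(s *: e + (x *: v2 + y *: v3)) 0] =
      quartic_section c s x y) /\
    forall x y, dform F (x *: v2 + y *: v3) e =
      cubic_part c x y.
Proof.
move=> homF F0; have [G [homG G0 GE]] := quartic_decomposition e0 e1 v2 v3 homF.
exists G; split=> // t0 t1 c e.
have cE i j a : (G i j).@[point2 (a * t0) (a * t1)] =
    if (i + j <= 4)%N then a ^+ (4 - (i + j)) * c i j else 0.
  case: leqP => ij; last by rewrite G0 // meval0.
  by rewrite (dhomog_eval2 _ _ _ (homG i j ij)).
have expand a z w : F.@[(a *: e + (z *: v2 + w *: v3)) 0] =
    quartic_section c a z w
      + (c 4%N 0%N * z ^+ 4 + c 3%N 1%N * z ^+ 3 * w + c 2%N 2%N * z ^+ 2 * w ^+ 2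
         + c 1%N 3%N * z * w ^+ 3 + c 0%N 4%N * w ^+ 4).
  rewrite /e scalerDr !scalerA !addrA GE !big_ord_recl !big_ord0 /= /bump /=.
  rewrite !add1n !cE !(addSn, add0n, subSS, subn0) /=.
  by rewrite /quartic_section /cubic_part; ring.
have E w : (c 4%N 0%N + c 3%N 1%N * w + c 2%N 2%N * w ^+ 2 + c 1%N 3%N * w ^+ 3
            + c 0%N 4%N * w ^+ 4) = 0.
  have := expand 0 1 w; rewrite scale0r add0r F0 => E0; rewrite [RHS]E0 /quartic_section; ring.
have Q0 : Poly [:: c 4%N 0%N; c 3%N 1%N; c 2%N 2%N; c 1%N 3%N; c 0%N 4%N] = 0.
  by apply: poly_eval_inj => w; rewrite horner_Poly /= horner0 -[RHS](E w); ring.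
have cQ k : nth 0 [:: c 4%N 0%N; c 3%N 1%N; c 2%N 2%N; c 1%N 3%N; c 0%N 4%N] k = 0.
  by rewrite -coef_Poly Q0 coef0.
have F_section s x y : F.@[(s *: e + (x *: v2 + y *: v3)) 0] =
      quartic_section c s x y.
  rewrite expand; move: (cQ 0%N) (cQ 1%N) (cQ 2%N) (cQ 3%N) (cQ 4%N) => /=.
  by do 5!move=> ->; ring.
split=> // x y.
pose Q := Poly [:: 0; cubic_part c x y;
  c 2%N 0%N * x ^+ 2 + c 1%N 1%N * x * y + c 0%N 2%N * y ^+ 2;
  c 1%N 0%N * x + c 0%N 1%N * y; c 0%N 0%N].
rewrite (@dform_unique _ _ _ _ Q) ?coef_Poly // => s.
by rewrite addrC F_section horner_Poly /quartic_section /=; ring.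
Qed.

Lemma dform_section F e v2 v3 : F \is 4.-homog ->
  (forall x y, F.@[(x *: v2 + y *: v3) 0] = 0) ->
  exists c30 c21 c12 c03, forall x y, dform F (x *: v2 + y *: v3) e =
    c30 * x ^+ 3 + c21 * x ^+ 2 * y + c12 * x * y ^+ 2 + c03 * y ^+ 3.
Proof.
move=> homF F0; have [G [_ GE]] := section_through_line e 0 homF F0.
pose c i j := (G i j).@[point2 1 0].
exists (c 3%N 0%N), (c 2%N 1%N), (c 1%N 2%N), (c 0%N 3%N) => x y.
by have [_ /(_ x y)] := GE 1 0; rewrite scale1r scaler0 addr0.
Qed.

End PlaneSections.

(** * Symmetries that preserve the planes through a line *)

Section PlanePreserving.
Variable K : numClosedFieldType.
Implicit Types (F : {mpoly K[4]}) (A : 'M[K]_4) (L : 'M[K]_(2, 4)).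
Implicit Types (p u v n e : 'rV[K]_4).

Lemma cube_root_of_unity : exists z : K, z ^+ 2 + z + 1 = 0.
Proof.
exists ((-1 + sqrtC (- 3%:R)) / 2%:R).
have two0 : 2%:R != 0 :> K by rewrite pnatr_eq0.
apply: (mulfI (expf_neq0 2 two0)); rewrite mulr0.
have := sqrtCK (- 3%:R : K); set r := sqrtC _ => rE.
have -> : 2%:R ^+ 2 * (((-1 + r) / 2%:R) ^+ 2 + (-1 + r) / 2%:R + 1) =
  r ^+ 2 + 3%:R by field.
by rewrite rE addNr.
Qed.

Lemma cube_root_of_unityP (z : K) : z ^+ 2 + z + 1 = 0 -> z ^+ 3 = 1 /\ z != 1.
Proof.
move=> zE; split.
  have -> : z ^+ 3 = (z - 1) * (z ^+ 2 + z + 1) + 1 by ring.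
  by rewrite zE mulr0 add0r.
apply: contra_eq_neq zE => ->.
by have -> : 1 ^+ 2 + 1 + 1 = 3%:R :> K; [ring | rewrite pnatr_eq0].
Qed.

(** A matrix with a nonzero scalar cube is annihilated by a polynomial with
simple roots. *)
Lemma cube_scalar_diagonalizable (a : 'M[K]_2) (mu : K) :
  mu != 0 -> a ^+ 3 = mu%:M ->
  exists2 P : 'M[K]_2, P \in unitmx & exists d, P *m a = diag_mx d *m P.
Proof.
move=> mu0 a3; have [z zE] := cube_root_of_unity.
have [z3 z1] := cube_root_of_unityP zE.
pose c := 3.-root mu; have c3 : c ^+ 3 = mu by rewrite rootCK.
have c0 : c != 0 by apply: contra_neq mu0 => c0; rewrite -c3 c0 expr0n.
have /diagonalizableP[P Pu /diagonalizable_forPex[d]] :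
  exists2 rs, uniq rs & mxminpoly a %| \prod_(x <- rs) ('X - x%:P).
  exists [:: c; c * z; c * z ^+ 2].
    have z2 : z ^+ 2 != 1 by apply: contra_neq z1 => z2; rewrite -z3 exprS z2 mulr1.
    have cz x y : (c * x == c * y) = (x == y) by apply: inj_eq; apply: mulfI.
    have zz : (z == z ^+ 2) = (z == 1).
      rewrite expr2 -{1}[z]mulr1 [RHS]eq_sym; apply: inj_eq; apply: mulfI.
      by apply: contra_eq_neq z3 => ->; rewrite expr0n eq_sym oner_eq0.
    have c1 x : (c == c * x) = (x == 1) by rewrite eq_sym -{2}[c]mulr1 cz.
    by rewrite /= !inE !negb_or !c1 cz zz z1 z2.
  have -> : \prod_(x <- [:: c; c * z; c * z ^+ 2]) ('X - x%:P) = 'X^3 - mu%:P.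
    apply: poly_eval_inj => x; rewrite !big_cons big_nil -c3 !hornerE /=.
    have kE : (z ^+ 2 + z + 1) *
        (c ^+ 2 * z * x - c * x ^+ 2 - c ^+ 3 * (z - 1)) = 0 by rewrite zE mul0r.
    by rewrite -[RHS]addr0 -kE; ring.
  by apply: mxminpoly_min; rewrite rmorphB rmorphXn /= horner_mx_X horner_mx_C a3 subrr.
by move=> /(simmxP Pu) Pa; exists P => //; exists d.
Qed.

Lemma vol_basis n p u v x : vol n p u v != 0 ->
  exists a b c d, x = a *: n + b *: p + (c *: u + d *: v).
Proof.
rewrite -unitfE -unitmxE; set M := \matrix_(i < 4) tnth [tuple n; p; u; v] i.
move=> Mu; pose y := x *m invmx M.
exists (y 0 (inord 0)), (y 0 (inord 1)), (y 0 (inord 2)), (y 0 (inord 3)).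
rewrite -{1}[x](mulmxKV Mu) -/y mulmx_sum_row !big_ord_recl big_ord0 addr0 !rowK.
rewrite !(tnth_nth 0) /= !addrA.
by do !congr (_ + _); congr (y 0 _ *: _); apply: val_inj; rewrite /= ?inordK.
Qed.

Lemma free_rows L : row_free L -> row 1 L != 0 /\ ~~ (row 0 L <= row 1 L)%MS.
Proof.
move=> /row_freeP[B LB]; split.
  apply/eqP => L1; have : row 1 (L *m B) = 0 by rewrite row_mul L1 mul0mx.
  by rewrite LB => /rowP/(_ 1)/eqP; rewrite !mxE eqxx oner_eq0.
apply/negP => /sub_rVP[a L01].
have : row 0 (L *m B) = a *: row 1 (L *m B) by rewrite !row_mul L01 scalemxAl.
by rewrite LB => /rowP/(_ 0)/eqP; rewrite !mxE /= mulr0 oner_eq0.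
Qed.

Lemma line_span L v2 v3 : \rank L = 2%N -> (v2 <= L)%MS -> (v3 <= L)%MS ->
  v3 != 0 -> ~~ (v2 <= v3)%MS ->
  forall p, (p <= L)%MS <-> exists x y, p = x *: v2 + y *: v3.
Proof.
move=> rL v2L v3L v3_neq0 v23 p; split; last first.
  by move=> [x [y ->]]; rewrite addmx_sub ?scalemx_sub.
have sub : (v2 + v3 <= L)%MS by rewrite addsmx_sub v2L.
have LE : (L <= v2 + v3)%MS.
  rewrite -(geq_leqif (mxrank_leqif_sup sub)) rL.
  by rewrite rank_pair.
move=> /submx_trans/(_ LE)/sub_addsmxP[[x y] /= ->].
exists (x 0 0), (y 0 0).
by rewrite [x]mx11_scalar [y]mx11_scalar !mul_scalar_mx !mxE eqxx.
Qed.

(** Points outside of the line are eigenvectors modulo the line, being moved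
within the plane that they span with it. *)
Lemma planes_scalar_mod_line L A : \rank L = 2%N -> A \in unitmx ->
  preserves_planes_through L A ->
  exists2 lam, lam != 0 & forall p, (p *m A - lam *: p <= L)%MS.
Proof.
move=> rL Au planesA.
have plane p : ~~ (p <= L)%MS -> exists a, (p *m A - a *: p <= L)%MS.
  move=> pL; pose P := col_mx L p.
  have rP : \rank P = 3%N.
    have : (\rank L < \rank (L + p)%MS)%N.
      by apply: rank_ltmx; rewrite ltmxE addsmxSl addsmx_sub submx_refl.
    by rewrite rL addsmxE => r3; apply/eqP; rewrite eqn_leq rank_leq_row.
  have LP : (L <= P)%MS by rewrite /P -addsmxE addsmxSl.
  have /andP[PA _] := planesA (P : 'M_(3, 4)) rP LP.
  have pP : (p <= P)%MS by rewrite /P -addsmxE addsmxSr.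
  have : (p *m A <= L + p)%MS by rewrite addsmxE; apply: submx_trans (submxMr A pP) PA.
  move=> /sub_addsmxP[[x y] /= ->]; exists (y 0 0).
  by rewrite {1}[y]mx11_scalar mul_scalar_mx addrK submxMl.
have Lfree : row_free L by rewrite /row_free rL.
have [v2 [v3 [v2L v3L v3_neq0 v23]]] : exists v2 v3,
    [/\ (v2 <= L)%MS, (v3 <= L)%MS, v3 != 0 & ~~ (v2 <= v3)%MS].
  by exists (row 0 L), (row 1 L); rewrite !row_sub; have [] := free_rows Lfree.
have [b0 [b1 V0]] := vol_neq0_extension v3_neq0 v23.
set V := vol _ _ _ _ in V0.
(* Coordinates modulo the line, up to the factor [V]. *)
pose f0 x := vol v2 v3 x b1; pose f1 x := vol v2 v3 b0 x.
have f0_lin a b x y : f0 (a *: x + b *: y) = a * f0 x + b * f0 y.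
  exact: vol_linear_u.
have f1_lin a b x y : f1 (a *: x + b *: y) = a * f1 x + b * f1 y.
  exact: vol_linear_v.
have f0L x : (x <= L)%MS -> f0 x = 0.
  move=> /(line_span rL v2L v3L v3_neq0 v23)[a [b ->]].
  by rewrite f0_lin /f0 vol_alt_nu vol_alt_pu !mulr0 addr0.
have f1L x : (x <= L)%MS -> f1 x = 0.
  move=> /(line_span rL v2L v3L v3_neq0 v23)[a [b ->]].
  by rewrite f1_lin /f1 vol_alt_nv vol_alt_pv !mulr0 addr0.
have f0b0 : f0 b0 = V by []. have f1b1 : f1 b1 = V by [].
have f0b1 : f0 b1 = 0 by apply: vol_alt_uv.
have f1b0 : f1 b0 = 0 by apply: vol_alt_uv.
have fL x : f0 x = 0 -> f1 x = 0 -> (x <= L)%MS.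
  have [a [b [c [d ->]]]] := vol_basis x V0.
  have abL : ((a *: v2 + b *: v3)%R <= L)%MS by rewrite addmx_sub ?scalemx_sub.
  rewrite -[a *: v2 + _]scale1r -[c *: b0 + _]scale1r f0_lin f1_lin f0L // f1L //.
  rewrite f0_lin f1_lin f0b0 f0b1 f1b0 f1b1 !(mulr0, add0r, addr0, mul1r).
  move=> /eqP; rewrite mulf_eq0 (negPf V0) orbF => /eqP ->.
  move=> /eqP; rewrite mulf_eq0 (negPf V0) orbF => /eqP ->.
  by rewrite !scale0r addr0 scaler0 addr0 scale1r.
have planeL p : f0 p != 0 \/ f1 p != 0 ->
    exists a, f0 (p *m A) = a * f0 p /\ f1 (p *m A) = a * f1 p.
  move=> fp; have /plane[a aL] : ~~ (p <= L)%MS.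
    by apply/negP => pL; case: fp; rewrite ?f0L ?f1L // eqxx.
  exists a; have pAE : p *m A = 1 *: (p *m A - a *: p) + a *: p.
    by rewrite scale1r subrK.
  by rewrite pAE f0_lin f1_lin f0L // f1L // !mulr0 !add0r.
have [a0 [A00 A01]] : exists a, f0 (b0 *m A) = a * V /\ f1 (b0 *m A) = 0.
  have [|a] := planeL b0; first by left.
  by rewrite f0b0 f1b0 mulr0 => aE; exists a.
have [a1 [A10 A11]] : exists a, f0 (b1 *m A) = 0 /\ f1 (b1 *m A) = a * V.
  have [|a] := planeL b1; first by right.
  by rewrite f0b1 f1b1 mulr0 => aE; exists a.
have a10 : a1 = a0.
  have [] := planeL (1 *: b0 + 1 *: b1).
    by left; rewrite f0_lin f0b0 f0b1 mulr0 addr0 mul1r.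
  rewrite mulmxDl -!scalemxAl => a [].
  rewrite !f0_lin !f1_lin A00 A01 A10 A11 f0b0 f0b1 f1b0 f1b1.
  rewrite !(mul1r, mulr0, addr0, add0r) => /(mulIf V0) -> /(mulIf V0) ->.
  by [].
have LA x : (x <= L)%MS -> f0 (x *m A) = 0 /\ f1 (x *m A) = 0.
  move=> xL; split.
    have [] := planeL (1 *: x + 1 *: b1).
      by right; rewrite f1_lin f1b1 (f1L _ xL) mulr0 add0r mul1r.
    rewrite mulmxDl -!scalemxAl => a [+ _].
    by rewrite !f0_lin A10 (f0L _ xL) f0b1 !(mulr0, addr0) mul1r.
  have [] := planeL (1 *: x + 1 *: b0).
    by left; rewrite f0_lin f0b0 (f0L _ xL) mulr0 add0r mul1r.
  rewrite mulmxDl -!scalemxAl => a [_].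
  by rewrite !f1_lin A01 (f1L _ xL) f1b0 !(mulr0, addr0) mul1r.
have scal p : (p *m A - a0 *: p <= L)%MS.
  have [a [b [c [d pE]]]] := vol_basis p V0.
  have lL : ((a *: v2 + b *: v3)%R <= L)%MS by rewrite addmx_sub ?scalemx_sub.
  have [lA0 lA1] := LA _ lL.
  have {}pE : p = 1 *: (a *: v2 + b *: v3) + 1 *: (c *: b0 + d *: b1).
    by rewrite !scale1r.
  have pA : p *m A = 1 *: ((a *: v2 + b *: v3) *m A)
      + 1 *: (c *: (b0 *m A) + d *: (b1 *m A)).
    by rewrite pE !mulmxDl !scale1r -!scalemxAl !mulmxDl -!scalemxAl.
  have -> : p *m A - a0 *: p = 1 *: (p *m A) + (- a0) *: p.
    by rewrite scale1r scaleNr.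
  apply: fL; rewrite (f0_lin, f1_lin) pA pE.
    by rewrite !f0_lin lA0 A00 A10 f0b0 f0b1 (f0L _ v2L) (f0L _ v3L); ring.
  by rewrite !f1_lin lA1 A01 A11 a10 f1b0 f1b1 (f1L _ v2L) (f1L _ v3L); ring.
exists a0 => //; apply: contra_neq V0 => a00.
have AL x : f0 (x *m A) = 0.
  by apply: f0L; have := scal x; rewrite a00 scale0r subr0.
by rewrite -f0b0 -[b0](mulmxKV Au) AL.
Qed.

(** The cube of [A] fixes all points of the line, hence is scalar on it. *)
Lemma line_eigenbasis L A : \rank L = 2%N -> A \in unitmx ->
  (L *m A <= L)%MS ->
  (forall p, p != 0 -> (p <= L)%MS -> (p *m A ^+ 3 == p)%MS) ->
  exists v2 v3 al be, [/\ (v2 <= L)%MS, (v3 <= L)%MS, v3 != 0 &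
    ~~ (v2 <= v3)%MS] /\ (v2 *m A = al *: v2 /\ v3 *m A = be *: v3).
Proof.
move=> rL Au /submxP[a LA] A3.
have Lfree : row_free L by rewrite /row_free rL.
have LA3 : L *m A ^+ 3 = a ^+ 3 *m L.
  have LAB (B : 'M_4) : L *m (A *m B) = a *m (L *m B).
    by rewrite mulmxA LA -mulmxA.
  by rewrite !exprS !expr0 !mulr1 -!mulmxE !LAB LA !mulmxA.
have eig (x : 'rV[K]_2) : exists m, x *m a ^+ 3 = m *: x.
  have [->|x0] := eqVneq x 0; first by exists 0; rewrite mul0mx scaler0.
  have xL0 : x *m L != 0 by rewrite mulmx_free_eq0.
  have /andP[] := A3 _ xL0 (submxMl _ _).
  rewrite -mulmxA LA3 mulmxA => /sub_rVP[m xm] _; exists m.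
  by apply: (row_free_inj Lfree); rewrite xm scalemxAl.
pose d0 : 'rV[K]_2 := delta_mx 0 0; pose d1 : 'rV[K]_2 := delta_mx 0 1.
have [m0 E0] := eig d0; have [m1 E1] := eig d1; have [m E] := eig (d0 + d1).
have a3 : a ^+ 3 = m%:M.
  move: E; rewrite mulmxDl E0 E1 => /rowP E.
  have m0E : m0 = m by have := E 0; rewrite !mxE /= !(mulr1, mulr0, addr0).
  have m1E : m1 = m by have := E 1; rewrite !mxE /= !(mulr1, mulr0, add0r).
  apply/row_matrixP => i; rewrite rowE [RHS]rowE mul_mx_scalar.
  have [->|->] : i = 0 \/ i = 1.
    by case: i => [[|[|//]] ?]; [left|right]; apply: val_inj.
  - by rewrite -/d0 E0 m0E.
  - by rewrite -/d1 E1 m1E.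
have m_neq0 : m != 0.
  apply/eqP => m0'; have A3u : A ^+ 3 \in unitmx by rewrite unitrX.
  have L0 : L = 0 by rewrite -[L](mulmxK A3u) LA3 a3 m0' raddf0 !mul0mx.
  by move: rL; rewrite L0 mxrank0.
have [P Pu [d Pa]] := cube_scalar_diagonalizable m_neq0 a3.
have PLA i : row i (P *m L) *m A = d 0 i *: row i (P *m L).
  rewrite -row_mul -mulmxA LA mulmxA Pa -mulmxA row_mul.
  by rewrite row_diag_mx -scalemxAl -rowE.
have PLfree : row_free (P *m L).
  by rewrite /row_free eqmxMfull ?rL // row_full_unit.
have [PL1 PL01] := free_rows PLfree.
exists (row 0 (P *m L)), (row 1 (P *m L)), (d 0 0), (d 0 1).
by split; [split=> //; rewrite row_mul submxMl | split].
Qed.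
End PlanePreserving.

(** The monomials are eigenvectors, and [z ^+ 6 = z ^+ 3 = 1] whereas
[z ^+ 4 = z] and [z ^+ 5 = z ^+ 2] are different from 1. *)
Lemma binary_cubic_invariant (K : numFieldType) (z c30 c21 c12 c03 : K) :
  z ^+ 3 = 1 -> z != 1 ->
  (forall x y, c30 * (z * x) ^+ 3 + c21 * (z * x) ^+ 2 * (z ^+ 2 * y)
      + c12 * (z * x) * (z ^+ 2 * y) ^+ 2 + c03 * (z ^+ 2 * y) ^+ 3 =
    c30 * x ^+ 3 + c21 * x ^+ 2 * y + c12 * x * y ^+ 2 + c03 * y ^+ 3) ->
  c21 = 0 /\ c12 = 0.
Proof.
move=> z3 z1 inv.
have E x y : (z - 1) * c21 * x ^+ 2 * y + (z ^+ 2 - 1) * c12 * x * y ^+ 2 = 0.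
  have := inv x y => /eqP; rewrite -subr_eq0 => /eqP <-.
  have w3 : (z ^+ 3 - 1) * (c30 * x ^+ 3 + c21 * z * x ^+ 2 * y
    + c12 * z ^+ 2 * x * y ^+ 2 + c03 * (z ^+ 3 + 1) * y ^+ 3) = 0.
    by rewrite z3 subrr mul0r.
  by rewrite -[LHS]addr0 -w3; ring.
have two0 : 2%:R != 0 :> K by rewrite pnatr_eq0.
have z2_neq1 : z ^+ 2 - 1 != 0.
  by rewrite subr_eq0; apply: contra_neq z1 => z2; rewrite -z3 exprS z2 mulr1.
have z1' : z - 1 != 0 by rewrite subr_eq0.
split.
  apply: (mulfI (mulf_neq0 two0 z1')).
  by rewrite mulr0 -[RHS](subrr 0) -{1}(E 1 1) -(E 1 (-1)); ring.
apply: (mulfI (mulf_neq0 two0 z2_neq1)).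
by rewrite mulr0 -[RHS](addr0 0) -{1}(E 1 1) -(E 1 (-1)); ring.
Qed.

Section LineOnSurface.
Variables (K : numClosedFieldType) (F : {mpoly K[4]}) (L : 'M[K]_(2, 4)).
Hypotheses (smF : smooth_quartic F) (lineL : line_on_surface F L).
Implicit Types (A B : 'M[K]_4) (p u v n e : 'rV[K]_4).

Let homF : F \is 4.-homog := proj1 smF.
Let rL : \rank L = 2%N := proj1 lineL.

Lemma line_on_cone p : p != 0 -> (p <= L)%MS -> on_cone F p.
Proof. by move=> p0 pL; rewrite /on_cone p0; apply: (proj2 lineL). Qed.

Lemma dform_line p u : (p <= L)%MS -> (u <= L)%MS -> dform F p u = 0.
Proof.
move=> pL uL; rewrite (@dform_unique _ _ _ _ 0) ?coef0 // => s.
rewrite horner0; apply/esym/eqP; apply: (proj2 lineL).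
by rewrite addmx_sub ?scalemx_sub.
Qed.

(** Dividing a symmetry by its eigenvalue modulo the line. *)
Lemma normalized_symmetry A : symmetry F A -> symplectic F A ->
  symmetry_order F A 3 -> preserves_planes_through L A ->
  exists B, [/\ B \in unitmx, forall p, (p *m B - p <= L)%MS,
    forall p n, on_cone F p ->
      dform F (p *m B) (n *m B) = \det B * dform F p n
    & forall p, on_surface F (p *m B) = on_surface F p] /\
    (trivial_on_surface F (B ^+ 3) /\ ~ trivial_on_surface F B).
Proof.
move=> symA sympA [_ A3 A12] planesA; have [Au FA] := symA.
have [lam lam0 lamL] := planes_scalar_mod_line rL Au planesA.
have trivZ (c : K) C : c != 0 ->
    trivial_on_surface F (c *: C) <-> trivial_on_surface F C.
  move=> c0; have eqC p : (p *m (c *: C) == p)%MS = (p *m C == p)%MS.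
    by rewrite -scalemxAr !(eqmx_scale _ c0).
  by split=> triv p /triv; rewrite eqC.
have l0 : lam^-1 != 0 by rewrite invr_eq0.
exists (lam^-1 *: A); split; last first.
  rewrite exprZn !trivZ ?expf_neq0 //; split=> //.
  by have := A12 1%N isT; rewrite expr1.
split=> [|p|p n Yp|p].
- by rewrite unitmxZ // unitfE.
- have -> : p *m (lam^-1 *: A) - p = lam^-1 *: (p *m A - lam *: p).
    by rewrite scalerBr scalerA mulVf // scale1r scalemxAr.
  exact: scalemx_sub.
- rewrite -!scalemxAr dformZZ // (symplectic_dform n smF symA sympA Yp).
  by rewrite detZ mulrA.
- rewrite -scalemxAr /on_surface quarticZ // mulf_eq0 expf_eq0 (negPf l0).
  exact: FA.
Qed.

Section Normalized.
Variable B : 'M[K]_4.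
Hypotheses (Bu : B \in unitmx) (BL : forall p, (p *m B - p <= L)%MS).
Hypothesis dB : forall p n, on_cone F p ->
  dform F (p *m B) (n *m B) = \det B * dform F p n.
Hypotheses (B3 : trivial_on_surface F (B ^+ 3)) (B1 : ~ trivial_on_surface F B).

(** Let [al] and [be] be the eigenvalues on the line. At a point of the line, the
derivative of [F] is a linear form modulo the line, on which [B] acts trivially,
and it depends cubically on the point. Comparing it at an eigenvector and at its
image gives [al ^+ 3 = al * be] and [be ^+ 3 = al * be], the determinant of [B]
being [al * be]. Hence [be = al ^+ 2] and [al ^+ 3 = 1]. If the eigenvalues were equal to 1, then [B] would be unipotent,
and could not have finite order without being trivial on the surface. *)
Lemma line_eigenvalues : exists v2 v3 z,
  [/\ (v2 <= L)%MS, (v3 <= L)%MS, v3 != 0 & ~~ (v2 <= v3)%MS] /\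
  [/\ v2 *m B = z *: v2, v3 *m B = z ^+ 2 *: v3, z ^+ 3 = 1 & z != 1] /\
  \det B = 1.
Proof.
have LB : (L *m B <= L)%MS.
  apply/row_subP => i; rewrite row_mul -[_ *m B](subrK (row i L)).
  by rewrite addmx_sub ?row_sub.
have LB3 p : p != 0 -> (p <= L)%MS -> (p *m B ^+ 3 == p)%MS.
  by move=> p0 pL; apply/B3/line_on_cone.
have [v2 [v3 [al [be [[v2L v3L v3_neq0 v23] [Bv2 Bv3]]]]]] :=
  line_eigenbasis rL Bu LB LB3.
have v2_neq0 : v2 != 0 by apply: contraNneq v23 => ->; rewrite sub0mx.
have eig_neq0 v a : v != 0 -> v *m B = a *: v -> a != 0.
  move=> v0 Bv; apply: contra_neq v0 => a0.
  by rewrite -[v](mulmxK Bu) Bv a0 scale0r mul0mx.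
have al0 := eig_neq0 _ _ v2_neq0 Bv2; have be0 := eig_neq0 _ _ v3_neq0 Bv3.
have detB : \det B = al * be.
  have [b0 [b1 V0]] := vol_neq0_extension v3_neq0 v23.
  apply: (mulfI V0); rewrite -vol_mulmx Bv2 Bv3.
  have spanL := line_span rL v2L v3L v3_neq0 v23.
  have [x0 [y0 E0]] := proj1 (spanL _) (BL b0).
  have [x1 [y1 E1]] := proj1 (spanL _) (BL b1).
  have -> : b0 *m B = 1 *: (x0 *: v2 + y0 *: v3) + 1 *: b0.
    by rewrite -E0 !scale1r subrK.
  have -> : b1 *m B = 1 *: (x1 *: v2 + y1 *: v3) + 1 *: b1.
    by rewrite -E1 !scale1r subrK.
  rewrite -[al *: v2]addr0 -(scale0r v2) -[be *: v3]addr0 -(scale0r v3).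
  rewrite !vol_linear_n !vol_linear_p !vol_linear_u !vol_linear_v.
  by rewrite !(vol_alt_nu, vol_alt_pu, vol_alt_nv, vol_alt_pv); ring.
have cube v a : v != 0 -> (v <= L)%MS -> v *m B = a *: v -> a ^+ 3 = al * be.
  move=> v0 vL Bv; have Yv := line_on_cone v0 vL.
  have [n dn] := smooth_dform smF Yv; have a0 := eig_neq0 _ _ v0 Bv.
  apply: (mulIf dn); rewrite -detB -dB // Bv.
  have -> : n *m B = 1 *: (n *m B - n) + 1 *: n by rewrite !scale1r subrK.
  rewrite dform_linear (dform_line (scalemx_sub a vL) (BL n)) mulr0 add0r mul1r.
  by apply: (mulIf a0); rewrite dformZ //; ring.
have be2 : be = al ^+ 2.
  by apply: (mulfI al0); rewrite -(cube _ _ v2_neq0 v2L Bv2); ring.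
have al2 : al = be ^+ 2.
  by apply: (mulIf be0); rewrite -(cube _ _ v3_neq0 v3L Bv3); ring.
have al3 : al ^+ 3 = 1.
  by apply: (mulfI al0); rewrite mulr1 [RHS]al2 be2; ring.
exists v2, v3, al; split=> //.
split; last by rewrite detB be2 -exprS.
split=> //; first by rewrite -be2.
apply/eqP => al1; apply: B1 => p Yp.
have be1 : be = 1 by rewrite be2 al1 expr1n.
have idL u : (u <= L)%MS -> u *m B = u.
  move=> /(line_span rL v2L v3L v3_neq0 v23)[x [y ->]].
  by rewrite mulmxDl -!scalemxAl Bv2 Bv3 al1 be1 !scale1r.
have [l lL pB] : exists2 l, (l <= L)%MS & p *m B = p + l.
  by exists (p *m B - p) => //; rewrite addrC subrK.
suff l0 : l = 0 by rewrite pB l0 addr0 submx_refl.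
have [pL|pL] := boolP (p <= L)%MS; first by apply: (addrI p); rewrite -pB idL // addr0.
have pB3 : p *m B ^+ 3 = p + 3%:R *: l.
  have lB : l *m B = l by apply: idL.
  rewrite !exprS expr0 mulr1 -!mulmxE !mulmxA pB !(mulmxDl, pB, lB) -!addrA.
  by rewrite scaler_nat !mulrS mulr0n addr0.
have /andP[/sub_rVP[m pm] _] := B3 Yp.
have E : 3%:R *: l = (m - 1) *: p by rewrite scalerBl -pm pB3 scale1r addrC addKr.
have three0 : 3%:R != 0 :> K by rewrite pnatr_eq0.
have [m1|m1] := eqVneq m 1.
  by move/eqP: E; rewrite m1 subrr scale0r scaler_eq0 (negPf three0) => /eqP.
case/negP: pL; have -> : p = ((m - 1)^-1 * 3%:R) *: l.
  by rewrite -scalerA E scalerA mulVf ?subr_eq0 // scale1r.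
exact: scalemx_sub.
Qed.

Section Eigenbasis.
Variables (v2 v3 : 'rV[K]_4) (z : K).
Hypotheses (v2L : (v2 <= L)%MS) (v3L : (v3 <= L)%MS) (v3_neq0 : v3 != 0).
Hypotheses (v23 : ~~ (v2 <= v3)%MS) (z3 : z ^+ 3 = 1) (z1 : z != 1).
Hypotheses (Bv2 : v2 *m B = z *: v2) (Bv3 : v3 *m B = z ^+ 2 *: v3).
Hypothesis detB : \det B = 1.

Let spanL := line_span rL v2L v3L v3_neq0 v23.

Let lineL_eval x y : F.@[(x *: v2 + y *: v3) 0] = 0.
Proof. by apply/eqP/(proj2 lineL)/spanL; exists x, y. Qed.

Let z2_neq1 : z ^+ 2 != 1.
Proof. by apply: contra_neq z1 => z2; rewrite -z3 exprS z2 mulr1. Qed.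

(** Of the binary cubic monomials only the cubes are invariant under [B]. *)
Lemma dform_fixed e x y : e *m B = e ->
  dform F (x *: v2 + y *: v3) e = x ^+ 3 * dform F v2 e + y ^+ 3 * dform F v3 e.
Proof.
move=> Be; have [c30 [c21 [c12 [c03 cE]]]] := dform_section e homF lineL_eval.
have inv a b : dform F ((z * a) *: v2 + (z ^+ 2 * b) *: v3) e =
    dform F (a *: v2 + b *: v3) e.
  have pB : (a *: v2 + b *: v3) *m B = (z * a) *: v2 + (z ^+ 2 * b) *: v3.
    by rewrite mulmxDl -!scalemxAl Bv2 Bv3 !scalerA mulrC [b * _]mulrC.
  rewrite -pB; have [->|p0] := eqVneq (a *: v2 + b *: v3) 0; first by rewrite mul0mx.
  rewrite -{1}Be dB ?detB ?mul1r //; apply: line_on_cone => //.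
  by apply/spanL; exists a, b.
have [|c21_0 c12_0] := binary_cubic_invariant z3 z1 (c30 := c30) (c21 := c21)
    (c12 := c12) (c03 := c03); first by move=> a b; rewrite -!cE inv.
have d2 := cE 1 0; have d3 := cE 0 1.
rewrite scale1r scale0r addr0 in d2; rewrite scale1r scale0r add0r in d3.
by rewrite cE d2 d3 c21_0 c12_0; ring.
Qed.

(** As 1 is not an eigenvalue on the line, the fixed vectors of [B] form a
complement of it. On this complement the derivatives of [F] at [v2] and [v3] are
independent: otherwise the surface would have a singular point on the line, whose
coordinates are cube roots of the coefficients of a linear relation. *)
Lemma fixed_dual_basis : exists e0 e1,
  [/\ e0 *m B = e0, e1 *m B = e1 & vol v2 v3 e0 e1 != 0] /\
  forall x y, dform F (x *: v2 + y *: v3) e0 = y ^+ 3 /\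
              dform F (x *: v2 + y *: v3) e1 = x ^+ 3.
Proof.
have fixed b : exists e, e *m B = e /\ exists x y, e = b + (x *: v2 + y *: v3).
  have [x [y bE]] := proj1 (spanL _) (BL b).
  have zz1 : 1 - z != 0 by rewrite subr_eq0 eq_sym.
  have zz2 : 1 - z ^+ 2 != 0 by rewrite subr_eq0 eq_sym.
  pose x' := x / (1 - z); pose y' := y / (1 - z ^+ 2).
  exists (b + (x' *: v2 + y' *: v3)); split; last by exists x', y'.
  have bB : b *m B = b + (x *: v2 + y *: v3) by rewrite -bE addrC subrK.
  rewrite !mulmxDl -!scalemxAl Bv2 Bv3 bB !scalerA -addrA addrACA -!scalerDl.
  by congr (b + (_ *: _ + _ *: _)); rewrite /x' /y'; field.
have [b0 [b1 V0]] := vol_neq0_extension v3_neq0 v23.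
have [f0 [Bf0 [x0 [y0 f0E]]]] := fixed b0.
have [f1 [Bf1 [x1 [y1 f1E]]]] := fixed b1.
have volf : vol v2 v3 f0 f1 = vol v2 v3 b0 b1.
  rewrite f0E f1E -[b0 + _]addr0 -[b1 in LHS]scale1r -[b0 in LHS]scale1r.
  rewrite -[_ *: v2 + _ in X in vol _ _ X _]scale1r.
  rewrite -[_ *: v2 + _ in X in vol _ _ _ X]scale1r addr0.
  rewrite !vol_linear_u !vol_linear_v.
  by rewrite !(vol_alt_nu, vol_alt_pu, vol_alt_nv, vol_alt_pv); ring.
pose a0 := dform F v2 f0; pose c0 := dform F v3 f0.
pose a1 := dform F v2 f1; pose c1 := dform F v3 f1.
pose D := a0 * c1 - a1 * c0.
have D0 : D != 0.
  apply/eqP => D0.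
  have [X [Y [XY E0 E1]]] : exists X Y, [/\ (X != 0) || (Y != 0),
      X * a0 + Y * c0 = 0 & X * a1 + Y * c1 = 0].
    have [ac0|ac0] := boolP ((a0 == 0) && (c0 == 0)).
      have /andP[/eqP -> /eqP ->] := ac0.
      have [ac1|ac1] := boolP ((a1 == 0) && (c1 == 0)).
        have /andP[/eqP -> /eqP ->] := ac1.
        by exists 1, 1; rewrite !mulr0 addr0 oner_eq0.
      exists c1, (- a1); rewrite oppr_eq0 -negb_and andbC; split=> //; ring.
    exists c0, (- a0); rewrite oppr_eq0 -negb_and andbC; split=> //; first by ring.
    by rewrite -[RHS]oppr0 -D0 /D; ring.
  pose x := 3.-root X; pose y := 3.-root Y.
  have x3 : x ^+ 3 = X by rewrite rootCK.
  have y3 : y ^+ 3 = Y by rewrite rootCK.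
  pose p := x *: v2 + y *: v3.
  have p0 : p != 0.
    apply: contraTneq XY => p0; have [x0'|x0'] := eqVneq x 0.
      move/eqP: p0; rewrite /p x0' scale0r add0r scaler_eq0 (negPf v3_neq0) orbF.
      by move=> /eqP y0'; rewrite -x3 -y3 x0' y0' expr0n eqxx.
    case/negP: v23; have -> : v2 = (- (y / x)) *: v3.
      apply: (scalerI x0'); rewrite scalerA mulrN mulrCA divff // mulr1 scaleNr.
      by apply/eqP; rewrite -addr_eq0; apply/eqP.
    exact: scalemx_sub.
  have Yp : on_cone F p by apply: line_on_cone => //; apply/spanL; exists x, y.
  have [n] := smooth_dform smF Yp; apply/negP; rewrite negbK.
  have V0' : vol v2 v3 f0 f1 != 0 by rewrite volf.
  have [a [b [c [d ->]]]] := vol_basis n V0'.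
  have pL : (p <= L)%MS by apply/spanL; exists x, y.
  rewrite -[a *: v2 + _]scale1r -[c *: f0 + _]scale1r !dform_linear.
  rewrite (dform_line pL v2L) (dform_line pL v3L) /p !dform_fixed // x3 y3 E0 E1.
  by rewrite !(mulr0, addr0).
exists (- (a1 / D) *: f0 + a0 / D *: f1), (c1 / D *: f0 + - (c0 / D) *: f1).
have fixedZ a b : (a *: f0 + b *: f1) *m B = a *: f0 + b *: f1.
  by rewrite mulmxDl -!scalemxAl Bf0 Bf1.
split=> [|x y].
  split; rewrite ?fixedZ // !vol_linear_u !vol_linear_v !vol_alt_uv (vol_swap_uv _ _ f0) volf.
  set V := vol _ _ _ _.
  have -> : - (a1 / D) * (c1 / D * 0 + - (c0 / D) * V) +
    a0 / D * (c1 / D * - V + - (c0 / D) * 0) = - V / D.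
    by rewrite /D; field.
  by rewrite mulf_neq0 ?invr_eq0 // oppr_eq0.
rewrite !dform_fixed ?fixedZ // !dform_linear -/a0 -/a1 -/c0 -/c1.
by split; rewrite /D; field.
Qed.

End Eigenbasis.
End Normalized.
End LineOnSurface.

(** * From a symmetry to the special form *)

Section SpecialForm.
Variable K : numClosedFieldType.
Implicit Types (F : {mpoly K[4]}) (B M : 'M[K]_4) (L : 'M[K]_(2, 4)).

Lemma binary_cubic_eq (c30 c21 c12 c03 a b : K) :
  (forall x y, c30 * x ^+ 3 + c21 * x ^+ 2 * y + c12 * x * y ^+ 2 + c03 * y ^+ 3
    = a * x ^+ 3 + b * y ^+ 3) -> [/\ c30 = a, c21 = 0, c12 = 0 & c03 = b].
Proof.
move=> E; have two0 : 2%:R != 0 :> K by rewrite pnatr_eq0.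
have E30 : c30 = a by have := E 1 0; rewrite !(expr1n, expr0n, mulr0, mulr1, addr0).
have E03 : c03 = b.
  by have := E 0 1; rewrite !(expr1n, expr0n, mulr0, mulr1, mul0r, add0r).
have E' x y : c21 * x ^+ 2 * y + c12 * x * y ^+ 2 = 0.
  by have /eqP := E x y; rewrite -subr_eq0 E30 E03 => /eqP <-; ring.
split=> //; apply: (mulfI two0); rewrite mulr0.
  by rewrite -[RHS](subrr 0) -{1}(E' 1 1) -(E' 1 (-1)); ring.
by rewrite -[RHS](addr0 0) -{1}(E' 1 1) -(E' 1 (-1)); ring.
Qed.

Lemma linear_coordinate_eval M j (p : 'rV[K]_4) :
  (linear_coordinate M j).@[p 0] = (p *m M) 0 j.
Proof.
rewrite /linear_coordinate raddf_sum mxE; apply: eq_bigr => i _ /=.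
by rewrite mevalZ mevalXU mulrC.
Qed.

Lemma special_form_eval M q g (p : 'rV[K]_4) :
  let y j := (p *m M) 0 (inord j) in
  (special_form (linear_coordinate M) q g).@[p 0] =
  y 0%N * y 3%N ^+ 3 + y 1%N * y 2%N ^+ 3
  + y 2%N * y 3%N * q.@[point2 (y 0%N) (y 1%N)] + g.@[point2 (y 0%N) (y 1%N)].
Proof.
move=> y; have pE : (fun i => (tnth [tuple linear_coordinate M (inord 0);
    linear_coordinate M (inord 1)] i).@[p 0]) =1 point2 (y 0%N) (y 1%N).
  by case=> [[|[|//]] ?]; rewrite /point2 !(tnth_nth 0) /= linear_coordinate_eval.
rewrite /special_form !mevalD !mevalM !comp_mpoly_meval.
by rewrite !linear_coordinate_eval !(meval_eq _ pE).
Qed.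

(** In the basis [e0], [e1], [v2], [v3] the cubic part of every plane section is
[x0 * x3 ^+ 3 + x1 * x2 ^+ 3], and the symmetry [B] excludes all other monomials
that are not in the special form. *)
Lemma special_of_normal_form F L B v2 v3 e0 e1 z :
  smooth_quartic F -> line_on_surface F L ->
  (forall p, (p <= L)%MS <-> exists x y, p = x *: v2 + y *: v3) ->
  [/\ e0 *m B = e0, e1 *m B = e1 & vol v2 v3 e0 e1 != 0] ->
  [/\ v2 *m B = z *: v2, v3 *m B = z ^+ 2 *: v3, z ^+ 3 = 1 & z != 1] ->
  (forall x y, dform F (x *: v2 + y *: v3) e0 = y ^+ 3 /\
               dform F (x *: v2 + y *: v3) e1 = x ^+ 3) ->
  (forall p, on_surface F (p *m B) = on_surface F p) ->
  special_line F L.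
Proof.
move=> [homF _] [_ FL] spanL [Be0 Be1 V0] [Bv2 Bv3 z3 z1] dE SB.
pose E := \matrix_(i < 4) tnth [tuple e0; e1; v2; v3] i.
have rowE (y : 'rV[K]_4) : y *m E = y 0 (inord 0) *: e0 + y 0 (inord 1) *: e1
    + (y 0 (inord 2) *: v2 + y 0 (inord 3) *: v3).
  rewrite mulmx_sum_row !big_ord_recl big_ord0 addr0 !rowK.
  rewrite !(tnth_nth 0) /= !addrA.
  by do !congr (_ + _); congr (y 0 _ *: _); apply: val_inj; rewrite /= ?inordK.
have combE a b c d : a *: e0 + b *: e1 + (c *: v2 + d *: v3) =
    (\row_(i < 4) tnth [tuple a; b; c; d] i) *m E.
  by rewrite rowE !mxE !(tnth_nth 0) !inordK.
have Eu : E \in unitmx.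
  rewrite -row_full_unit -sub1mx; apply/row_subP => i.
  have [a [b [c [d ->]]]] := vol_basis (row i 1%:M) V0.
  by rewrite addrC combE submxMl.
pose M := invmx E; exists M.
have coordE a b c d : (a *: e0 + b *: e1 + (c *: v2 + d *: v3)) *m M =
    \row_(i < 4) tnth [tuple a; b; c; d] i by rewrite combE mulmxK.
have lineF x y : F.@[(x *: v2 + y *: v3) 0] = 0.
  by apply/eqP/FL/spanL; exists x, y.
have [G [homG GE]] := section_through_line e0 e1 homF lineF.
exists (G 1%N 1%N), (G 0%N 0%N), 1; split; last split.
- by split; rewrite ?unitmx_inv ?oner_eq0 //; apply: homG.
- move=> p; apply/idP/andP => [/spanL[x [y ->]]|[/eqP y0 /eqP y1]].
    have -> : x *: v2 + y *: v3 = 0 *: e0 + 0 *: e1 + (x *: v2 + y *: v3).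
      by rewrite !scale0r !add0r.
    by rewrite coordE !mxE !(tnth_nth 0) !inordK.
  apply/spanL; exists ((p *m M) 0 (inord 2)), ((p *m M) 0 (inord 3)).
  by rewrite -{1}[p](mulmxKV Eu) rowE y0 y1 !scale0r !add0r.
have lin_neq0 (j : 'I_4) : linear_coordinate M j != 0.
  apply/eqP => lin0; have := linear_coordinate_eval M j (row j E).
  rewrite lin0 meval0 -row_mul mulmxV // !mxE eqxx => /esym/eqP.
  by rewrite oner_eq0.
(* It suffices to compare the values where the first two coordinates are nonzero,
   that is, where the residual cubic meets the line in three distinct points. *)
rewrite scale1r.
apply: (mulfI (lin_neq0 (inord 0))); apply: (mulfI (lin_neq0 (inord 1))).
apply: mpoly_eval_inj => v; pose p : 'rV[K]_4 := \row_i v i.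
have vp : v =1 p 0 by move=> i; rewrite mxE.
rewrite !(meval_eq _ vp) !mevalM !linear_coordinate_eval special_form_eval.
set t0 := (p *m M) 0 (inord 0); set t1 := (p *m M) 0 (inord 1).
set x2 := (p *m M) 0 (inord 2); set x3 := (p *m M) 0 (inord 3).
have [->|t0_neq0] := eqVneq t0 0; first by rewrite !mul0r !mulr0.
have [->|t1_neq0] := eqVneq t1 0; first by rewrite !mul0r.
congr (_ * (_ * _)).
have pE : p = 1 *: (t0 *: e0 + t1 *: e1) + (x2 *: v2 + x3 *: v3).
  by rewrite scale1r -{1}[p](mulmxKV Eu) rowE.
pose c i j := (G i j).@[point2 t0 t1].
have [F_section dF_section] := GE t0 t1.
have [c30 c21 c12 c03] : [/\ c 3%N 0%N = t1, c 2%N 1%N = 0, c 1%N 2%N = 0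
    & c 0%N 3%N = t0].
  apply: binary_cubic_eq => x y; have := dF_section x y; rewrite /cubic_part => <-; rewrite dform_linear.
  by have [-> ->] := dE x y; rewrite addrC.
rewrite /c in c30 c21 c12 c03.
have [c20 c02 c10 c01] : [/\ c 2%N 0%N = 0, c 0%N 2%N = 0, c 1%N 0%N = 0
    & c 0%N 1%N = 0].
  apply: (symmetric_cubic_coefs z3 z1 (c11 := c 1%N 1%N) (c00 := c 0%N 0%N)
    t1_neq0 t0_neq0) => s y s0 sy.
  pose r : 'rV[K]_4 := s *: (t0 *: e0 + t1 *: e1) + (1 *: v2 + y *: v3).
  have rB : r *m B = s *: (t0 *: e0 + t1 *: e1)
      + ((z * 1) *: v2 + (z ^+ 2 * y) *: v3).
    rewrite /r !mulmxDl -!scalemxAl mulmxDl -!scalemxAl Be0 Be1 Bv2 Bv3.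
    by rewrite !scalerA !(mulrC z, mulrC (z ^+ 2)).
  have : on_surface F r.
    rewrite /on_surface /r F_section /quartic_section /cubic_part c30 c21 c12 c03; apply/eqP.
    have E0 := etrans (congr1 ( *%R s) sy) (mulr0 s).
    by rewrite -[RHS]E0 /c; ring.
  rewrite -SB rB /on_surface F_section /quartic_section /cubic_part c30 c21 c12 c03 => /eqP Fr.
  have w3 : (z ^+ 3 - 1) * (s * (t1 + t0 * y ^+ 3 * (z ^+ 3 + 1))
    + s ^+ 2 * (c 1%N 1%N * y + z * c 0%N 2%N * y ^+ 2)) = 0.
    by rewrite z3 subrr mul0r.
  have E0 := etrans (congr2 (fun a b => a - b) Fr w3) (subrr 0).
  by apply: (mulfI s0); rewrite mulr0 -[RHS]E0 /c; ring.
rewrite /c in c20 c02 c10 c01.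
rewrite {1}pE F_section /quartic_section /cubic_part c30 c21 c12 c03 c20 c02 c10 c01; ring.
Qed.
End SpecialForm.

(** * Regular functions on the surface *)

Section RationalFunctionsOfOneVariable.
Variable K : numClosedFieldType.

Definition rational_near (phi : K -> K) (t0 : K) : Prop :=
  exists n d : {poly K}, d.[t0] != 0 /\
    forall t, d.[t] != 0 -> phi t = n.[t] / d.[t].

(** A fraction in lowest terms that represents the function somewhere represents
it everywhere, and its denominator has no zeros. *)
Lemma rational_near_polynomial (phi : K -> K) :
  (forall t0, rational_near phi t0) ->
  exists Q : {poly K}, forall t, phi t = Q.[t].
Proof.
move=> phi_rat; have [n [d [d0 phiE]]] := phi_rat 0.
have d_neq0 : d != 0 by apply: contraNneq d0 => ->; rewrite horner0.
pose g := gcdp n d; pose n' := n %/ g; pose d' := d %/ g.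
have g_neq0 : g != 0 by rewrite gcdp_eq0 negb_and d_neq0 orbT.
have nE : n = n' * g by rewrite divpK // dvdp_gcdl.
have dE : d = d' * g by rewrite divpK // dvdp_gcdr.
have coprime_d'n' : coprimep d' n'.
  by rewrite coprimep_sym coprimep_div_gcd // d_neq0 orbT.
have local t0 : d'.[t0] != 0 /\ phi t0 * d'.[t0] = n'.[t0].
  have [n1 [d1 [d1t0 phi1E]]] := phi_rat t0.
  have d1_neq0 : d1 != 0 by apply: contraNneq d1t0 => ->; rewrite horner0.
  have cross : n1 * d' = n' * d1.
    apply: (mulIf g_neq0); rewrite -mulrA -dE mulrAC -nE.
    apply: (mulIf (mulf_neq0 d_neq0 d1_neq0)); apply: poly_eval_inj => t.
    rewrite !hornerM; have [dt|dt] := eqVneq d.[t] 0; first by rewrite dt !(mul0r, mulr0).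
    have [d1t|d1t] := eqVneq d1.[t] 0; first by rewrite d1t !(mul0r, mulr0).
    congr (_ * _); have := phi1E t d1t; rewrite phiE // => /eqP.
    by rewrite eqr_div // eq_sym => /eqP.
  have d'd1 : d' %| d1.
    by rewrite -(Gauss_dvdpr d1 coprime_d'n') -cross dvdp_mull.
  have d't0 : d'.[t0] != 0.
    apply: contraNneq d1t0 => d't0; have [q ->] := dvdpP _ _ d'd1.
    by rewrite hornerM d't0 mulr0.
  split=> //; rewrite phi1E //; apply: (mulIf d1t0).
  by rewrite mulrAC divfK // -!hornerM cross.
have /eqP/size_poly1P[c c0 d'E] : size d' = 1%N.
  apply/eqP; apply: contraT => /closed_rootP[t]; have [+ _] := local t.
  by rewrite rootE => /negPf ->.
exists (c^-1 *: n') => t; have [_] := local t.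
by rewrite d'E hornerC hornerZ => <-; rewrite mulrCA mulVf // mulr1.
Qed.

(** A function without poles on the affine line is a polynomial, and its degree is
the order of its pole at infinity, near which it is given by [n] and [d]. *)
Lemma rational_constant (phi : K -> K) (n d : {poly K}) :
  (forall t0, rational_near phi t0) -> d.[0] != 0 ->
  (forall s, s != 0 -> d.[s] != 0 -> phi s^-1 = n.[s] / d.[s]) ->
  forall t, phi t = n.[0] / d.[0].
Proof.
move=> /rational_near_polynomial[Q QE] d0 phi_inf.
have d_neq0 : d != 0 by apply: contraNneq d0 => ->; rewrite horner0.
(* [R] is the reciprocal polynomial of [Q]. *)
pose k := (size Q).-1; pose R := \poly_(i < k.+1) Q`_(k - i).
have RE s : s != 0 -> R.[s] = s ^+ k * Q.[s^-1].
  move=> s0; rewrite horner_poly [Q.[_]](@horner_coef_wide _ k.+1) ?leqSpred //.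
  rewrite mulr_sumr (reindex_inj rev_ord_inj) /=; apply: eq_bigr => i _.
  rewrite subSS subKn -1?ltnS // mulrCA; congr (_ * _).
  by rewrite exprVn -expfB_cond ?(negPf s0) ?add0n // -ltnS.
have cross : R * d = 'X^k * n.
  have X_neq0 : 'X != 0 :> {poly K} by rewrite polyX_eq0.
  apply: (mulIf (mulf_neq0 d_neq0 X_neq0)); apply: poly_eval_inj => s.
  rewrite !hornerM hornerXn hornerX.
  have [->|s0] := eqVneq s 0; first by rewrite !mulr0.
  have [->|ds] := eqVneq d.[s] 0; first by rewrite !(mul0r, mulr0).
  by rewrite RE // -QE phi_inf // -[_ * _ * d.[s]]mulrA divfK.
have R0 : R.[0] = lead_coef Q.
  by rewrite horner_coef0 coef_poly subn0 lead_coefE.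
have k0 : k = 0%N.
  apply/eqP; apply: contraT => k_neq0; have := congr1 (horner^~ 0) cross.
  rewrite !hornerM R0 hornerXn expr0n (negPf k_neq0) mul0r => /eqP.
  rewrite mulf_eq0 (negPf d0) orbF lead_coef_eq0 => /eqP Q0.
  by move: k_neq0; rewrite /k Q0 size_poly0.
have sQ : (size Q <= 1)%N by move: k0; rewrite /k; case: (size Q) => [|[]].
move=> t; rewrite QE (size1_polyC sQ) hornerC; apply: (mulIf d0); rewrite divfK //.
have := congr1 (horner^~ 0) cross; rewrite !hornerM R0 hornerXn k0 expr0 mul1r => <-.
by rewrite lead_coefE -/k k0.
Qed.

End RationalFunctionsOfOneVariable.

Section RegularFunctions.
Variables (K : numClosedFieldType) (F : {mpoly K[4]}).
Implicit Types (p u v n m : 'rV[K]_4) (f : 'rV[K]_4 -> K).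

(** A function on the surface is a scaling invariant function on the cone, just as
for the 2-forms. *)
Definition regular_function f : Prop :=
  (forall c p, c != 0 -> on_cone F p -> f (c *: p) = f p) /\
  forall p0, on_cone F p0 -> exists a h : {mpoly K[4]}, h.@[p0 0] != 0 /\
    forall p, on_cone F p -> h.@[p 0] != 0 -> f p = a.@[p 0] / h.@[p 0].

Definition denominator f (a h : {mpoly K[4]}) : Prop :=
  forall p, on_cone F p -> f p * h.@[p 0] = a.@[p 0].

(** Denominators form an ideal, and the general linear combination of two of them
vanishes at none of finitely many points that are not zeros of both. *)
Lemma common_denominator f (ps : seq 'rV[K]_4) : regular_function f ->
  all (on_cone F) ps ->
  exists a h, denominator f a h /\ all (fun p => h.@[p 0] != 0) ps.
Proof.
move=> [_ f_loc]; elim: ps => [_|p ps IHps /= /andP[Yp /IHps[a [h [fah h_ps]]]]].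
  by exists 0, 0; split=> // p _; rewrite !meval0 mulr0.
have [a1 [h1 [h1p fE]]] := f_loc p Yp.
(* Multiplication by [h1] makes the local equality hold where [h1] vanishes. *)
have fah1 : denominator f (a1 * h1) (h1 * h1).
  move=> r Yr; rewrite !mevalM; have [->|h1r] := eqVneq h1.@[r 0] 0.
    by rewrite !mulr0.
  by rewrite fE // mulrA divfK.
pose comb (r : 'rV[K]_4) : {poly K} := h.@[r 0]%:P + (h1.@[r 0] ^+ 2) *: 'X.
have comb_neq0 r : r \in p :: ps -> comb r != 0.
  rewrite inE => rps; apply/eqP => comb0.
  have := congr1 (fun P : {poly K} => P`_0) comb0.
  have := congr1 (fun P : {poly K} => P`_1) comb0.
  rewrite !(coefD, coefC, coefZ, coefX, coef0) /= mulr1 mulr0 add0r addr0.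
  move=> /eqP; rewrite expf_eq0 /= => h1r hr; case/orP: rps => [/eqP rp|r_ps].
    by rewrite rp (negPf h1p) in h1r.
  by have /allP/(_ r r_ps) := h_ps; rewrite hr eqxx.
have [lam] : exists lam, (\prod_(r <- p :: ps) comb r).[lam] != 0.
  by apply: poly_nonroot; rewrite prodf_seq_neq0; apply/allP => r /comb_neq0.
rewrite horner_prod prodf_seq_neq0 => lam_ps.
exists (a + lam *: (a1 * h1)), (h + lam *: (h1 * h1)); split.
  move=> r Yr; rewrite !mevalD !mevalZ mulrDr fah // mulrCA -fah1 //.
apply: sub_all lam_ps => r /=.
by rewrite !hornerE mevalD mevalZ mevalM expr2 mulrC.
Qed.

Lemma on_coneZ c p : F \is 4.-homog -> c != 0 -> on_cone F (c *: p) = on_cone F p.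
Proof.
move=> homF c0; rewrite /on_cone /on_surface quarticZ // mulf_eq0 expf_eq0.
by rewrite scaler_eq0 (negPf c0).
Qed.

Lemma mpoly_line (a : {mpoly K[4]}) u v :
  exists Q : {poly K}, forall t, Q.[t] = a.@[(u + t *: v) 0].
Proof. by have [Q [QE _]] := line_poly4 a u v; exists Q. Qed.

(** On a line in the surface a regular function is a function of one variable
without poles. *)
Lemma regular_function_line f n m : regular_function f ->
  (forall x y, F.@[(x *: n + y *: m) 0] = 0) ->
  (forall x y, x *: n + y *: m = 0 -> x = 0 /\ y = 0) ->
  forall t, f (n + t *: m) = f m.
Proof.
move=> f_reg F0 free; have [f_hom f_loc] := f_reg.
have Y x y : (x != 0) || (y != 0) -> on_cone F (x *: n + y *: m).
  move=> xy; rewrite /on_cone /on_surface F0 eqxx andbT.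
  by apply: contraTneq xy => /free[-> ->]; rewrite eqxx.
have Y1 t : on_cone F (n + t *: m) by rewrite -[n]scale1r Y ?oner_eq0.
have Y2 s : on_cone F (m + s *: n).
  by rewrite -[m]scale1r addrC Y ?oner_eq0 ?orbT.
have [a [h [hm fE]]] := f_loc _ (Y2 0).
have [A AE] := mpoly_line a m n; have [H HE] := mpoly_line h m n.
move=> t; rewrite (@rational_constant K (fun t => f (n + t *: m)) A H).
- by rewrite AE HE -fE //; congr f; rewrite scale0r addr0.
- move=> t0; have [a1 [h1 [h1t0 f1E]]] := f_loc _ (Y1 t0).
  have [A1 A1E] := mpoly_line a1 n m; have [H1 H1E] := mpoly_line h1 n m.
  by exists A1, H1; rewrite H1E; split=> // r; rewrite A1E H1E; apply: f1E.
- by rewrite HE.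
move=> s s0; rewrite AE HE => hs; rewrite -fE // -(f_hom s _ s0) //.
by rewrite scalerDr scalerA divff // scale1r addrC.
Qed.

End RegularFunctions.

(** * Norms from a cubic extension *)

Section CubicNorm.
Variable K : numClosedFieldType.
Variables (u0 u1 m : 'rV[K]_4) (c1 c0 : {poly K}).

(** On the points of the curve given by a monic cubic equation in [y], polynomials
reduce to quadratic polynomials in [y]. *)
Lemma reduce_mod_cubic (a : {mpoly K[4]}) : exists al be ga : {poly K},
  forall t y, y ^+ 3 + c1.[t] * y + c0.[t] = 0 ->
    a.@[(u0 + t *: u1 + y *: m) 0] = al.[t] + be.[t] * y + ga.[t] * y ^+ 2.
Proof.
elim/mpoly_generated_ind: a => [c|i|a b [al [be [ga aE]]] [al' [be' [ga' bE]]]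
                                   |a b [al [be [ga aE]]] [al' [be' [ga' bE]]]].
- by exists c%:P, 0, 0 => t y _; rewrite mevalC hornerC !horner0 !mul0r !addr0.
- exists ((u0 0 i)%:P + u1 0 i *: 'X), (m 0 i)%:P, 0 => t y _.
  by rewrite mevalXU !mxE !hornerE /=; ring.
- exists (al + al'), (be + be'), (ga + ga') => t y yE.
  by rewrite mevalD (aE t y yE) (bE t y yE) !hornerD; ring.
exists (al * al' - c0 * (be * ga' + ga * be')),
  (al * be' + be * al' - c1 * (be * ga' + ga * be') - c0 * (ga * ga')),
  (al * ga' + be * be' + ga * al' - c1 * (ga * ga')) => t y yE.
rewrite mevalM (aE t y yE) (bE t y yE) !(hornerD, hornerN, hornerM).
have E0 : (y ^+ 3 + c1.[t] * y + c0.[t]) *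
  (be.[t] * ga'.[t] + ga.[t] * be'.[t] + ga.[t] * ga'.[t] * y) = 0.
  by rewrite yE mul0r.
by rewrite -[RHS]addr0 -E0; ring.
Qed.

(** The three roots, with multiplicities, are encoded by Viete's relations, from
which the norms are computed. *)
Definition cubic_roots (t : K) (r : K * K * K) : Prop :=
  [/\ r.1.1 + r.1.2 + r.2 = 0, r.1.1 * r.1.2 + r.1.1 * r.2 + r.1.2 * r.2 = c1.[t]
    & r.1.1 * r.1.2 * r.2 = - c0.[t]].

(** The norm of [al + be * y + ga * y ^+ 2] is a polynomial in its coefficients
and those of the cubic. *)
Lemma cubic_norm (a : {mpoly K[4]}) : exists N : {poly K},
  forall t r, cubic_roots t r ->
    N.[t] = a.@[(u0 + t *: u1 + r.1.1 *: m) 0] *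
            a.@[(u0 + t *: u1 + r.1.2 *: m) 0] * a.@[(u0 + t *: u1 + r.2 *: m) 0].
Proof.
have [al [be [ga aE]]] := reduce_mod_cubic a.
exists (al ^+ 3 - 2%:R * al ^+ 2 * ga * c1 + al * be ^+ 2 * c1
  + 3%:R * al * be * ga * c0 + al * ga ^+ 2 * c1 ^+ 2 - be ^+ 3 * c0
  - be * ga ^+ 2 * c1 * c0 + ga ^+ 3 * c0 ^+ 2).
move=> t [[r1 r2] r3] [/= s1 s2 s3].
have r3E : r3 = - r1 - r2 by rewrite -[RHS]add0r -s1; ring.
have c1E : c1.[t] = r1 * r2 + r1 * r3 + r2 * r3 by [].
have c0E : c0.[t] = - (r1 * r2 * r3) by rewrite s3 opprK.
rewrite !aE ?c1E ?c0E ?r3E; try ring.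
rewrite !(hornerE, hornerMn) /= c1E c0E r3E; ring.
Qed.

End CubicNorm.

(** * Regular functions on plane cubics *)

Section PlaneCubic.
Variables (K : numClosedFieldType) (F : {mpoly K[4]}) (f : 'rV[K]_4 -> K).
Variables (T n m : 'rV[K]_4) (k q k' g : K).
Hypotheses (homF : F \is 4.-homog) (f_reg : regular_function F f) (k_neq0 : k != 0).
Hypothesis section_TF : forall s x y, F.@[(s *: T + x *: n + y *: m) 0] =
  s * k * (y ^+ 3 + q * s * x * y + k' * x ^+ 3 + g * s ^+ 3).
Hypothesis free_Tnm : forall s x y, s *: T + x *: n + y *: m = 0 ->
  [/\ s = 0, x = 0 & y = 0].

Let on_coneE s x y : [|| s != 0, x != 0 | y != 0] ->
  s * k * (y ^+ 3 + q * s * x * y + k' * x ^+ 3 + g * s ^+ 3) = 0 ->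
  on_cone F (s *: T + x *: n + y *: m).
Proof.
move=> sxy E; rewrite /on_cone /on_surface section_TF E eqxx andbT.
by apply: contraTneq sxy => /free_Tnm[-> -> ->]; rewrite eqxx.
Qed.

Lemma cubic_roots_exist (c1 c0 : {poly K}) t : exists r, cubic_roots c1 c0 t r.
Proof.
have [r1 [r2 [r3 [E1 E2 E3]]]] := cubic_split 0 c1.[t] c0.[t] (oner_neq0 K).
exists (r1, r2, r3); split=> /=; last by rewrite E3; ring.
  by apply/eqP; rewrite -oppr_eq0 -mulN1r -E1.
by rewrite E2 mul1r.
Qed.

(** The plane section consists of the line spanned by [n] and [m] and a cubic
curve, which is projected from [m] to the projective line with fibres of three
points. If [f] took a value different from [f m] on the cubic, the product of
its differences with that value over the fibres would be a function without
poles, hence a constant; but it would vanish somewhere, and not on the fibre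
[s = 0], which is contained in the line. *)
Lemma plane_cubic_constant x0 y0 : on_surface F (T + x0 *: n + y0 *: m) ->
  f (T + x0 *: n + y0 *: m) = f m.
Proof.
move=> Fp; have [f_hom f_loc] := f_reg; set p0 := T + _ + _ in Fp *.
apply: contraTeq isT => fp0_neq; set ka := f p0 in fp0_neq.
have f_line t : f (n + t *: m) = f m.
  apply: (regular_function_line f_reg) => [x y|x y].
    by have := section_TF 0 x y; rewrite scale0r add0r !mul0r.
  by have := @free_Tnm 0 x y; rewrite scale0r add0r => E /E[].
pose c1 : {poly K} := q *: 'X.
pose c0 : {poly K} := k' *: 'X^3 + g%:P.
pose c0' : {poly K} := k'%:P + g *: 'X^3.
(* [c1] and [c0] are the coefficients of the cubic where [s = 1], and [c1] and
   [c0'] those where the coordinate along [n] is 1. *)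
have [r rP] := boolp.choice (cubic_roots_exist c1 c0).
pose P t y := T + t *: n + y *: m.
have YP t y : y ^+ 3 + c1.[t] * y + c0.[t] = 0 -> on_cone F (P t y).
  move=> yE; have := @on_coneE 1 t y; rewrite oner_eq0 scale1r; apply=> //.
  rewrite mul1r -[RHS](mulr0 k) -[in RHS]yE /c1 /c0 !hornerE /=; ring.
have root_eq c c' t (s : K * K * K) (y : K) : cubic_roots c c' t s ->
    (y - s.1.1) * (y - s.1.2) * (y - s.2) = y ^+ 3 + c.[t] * y + c'.[t].
  case=> s1 s2 s3; rewrite -s2 -[c'.[t]]opprK -s3.
  have -> : s.2 = - s.1.1 - s.1.2 by rewrite -[RHS]add0r -s1; ring.
  ring.
have roots_on (c c' : {poly K}) t s : cubic_roots c c' t s ->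
    [/\ s.1.1 ^+ 3 + c.[t] * s.1.1 + c'.[t] = 0,
        s.1.2 ^+ 3 + c.[t] * s.1.2 + c'.[t] = 0 &
        s.2 ^+ 3 + c.[t] * s.2 + c'.[t] = 0].
  by move=> sP; rewrite -!(root_eq _ _ _ _ _ sP) !subrr !(mul0r, mulr0).
pose phi t := (f (P t (r t).1.1) - ka) * (f (P t (r t).1.2) - ka)
  * (f (P t (r t).2) - ka).
pose b (a h : {mpoly K[4]}) := a - ka *: h.
have fbE a h p : denominator F f a h -> on_cone F p -> h.@[p 0] != 0 ->
    f p - ka = (b a h).@[p 0] / h.@[p 0].
  move=> fah Yp hp; apply: (mulIf hp); rewrite divfK // mulrBl fah //.
  by rewrite /b mevalB mevalZ.
have YP3 t : [/\ on_cone F (P t (r t).1.1), on_cone F (P t (r t).1.2) &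
    on_cone F (P t (r t).2)].
  by have [E1 E2 E3] := roots_on _ _ _ _ (rP t); split; apply: YP.
have phi_rat t0 : rational_near phi t0.
  have [Y1 Y2 Y3] := YP3 t0.
  have [|a [h [fah]]] := common_denominator (ps := [:: P t0 (r t0).1.1;
    P t0 (r t0).1.2; P t0 (r t0).2]) f_reg; first by rewrite /= Y1 Y2 Y3.
  rewrite /= andbT => /and3P[h1 h2 h3].
  have [N NE] := cubic_norm T n m c1 c0 (b a h).
  have [D DE] := cubic_norm T n m c1 c0 h.
  exists N, D; rewrite (DE _ _ (rP t0)) !mulf_neq0 //; split=> // t.
  rewrite (DE _ _ (rP t)) (NE _ _ (rP t)) !mulf_eq0 !negb_or.
  move=> /andP[/andP[d1 d2] d3]; have [Y1' Y2' Y3'] := YP3 t.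
  by rewrite /phi !(fbE a h) // -!mulf_div.
(* The fibre at infinity. *)
have [r' r'P] := cubic_roots_exist c1 c0' 0.
have Y0 y : on_cone F (n + 0 *: T + y *: m).
  have := @on_coneE 0 1 y; rewrite oner_eq0 orbT mul0r mul0r scale1r [n + _]addrC.
  exact.
have [|a [h [fah]]] := common_denominator (ps := [:: n + 0 *: T + r'.1.1 *: m;
  n + 0 *: T + r'.1.2 *: m; n + 0 *: T + r'.2 *: m]) f_reg; first by rewrite /= !Y0.
rewrite /= andbT => /and3P[h1 h2 h3].
have [N NE] := cubic_norm n T m c1 c0' (b a h).
have [D DE] := cubic_norm n T m c1 c0' h.
have D0 : D.[0] != 0 by rewrite (DE _ _ r'P) !mulf_neq0.
have scale_P s y : s != 0 -> s *: P s^-1 y = n + s *: T + (s * y) *: m.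
  by move=> s0; rewrite /P !scalerDr !scalerA divff // scale1r [s *: T + n]addrC.
have phi_inf s : s != 0 -> D.[s] != 0 -> phi s^-1 = N.[s] / D.[s].
  move=> s0; have [Y1 Y2 Y3] := YP3 s^-1.
  have sP : cubic_roots c1 c0' s (s * (r s^-1).1.1, s * (r s^-1).1.2, s * (r s^-1).2).
    have [e1 e2 e3] := rP s^-1; split=> /=.
    - by rewrite -!mulrDr e1 mulr0.
    - have -> : c1.[s] = s ^+ 2 * c1.[s^-1] by rewrite /c1 !hornerE /=; field.
      by rewrite -e2; ring.
    have -> : c0'.[s] = s ^+ 3 * c0.[s^-1] by rewrite /c0 /c0' !hornerE /=; field.
    by rewrite -mulrN -e3; ring.
  rewrite (DE _ _ sP) (NE _ _ sP) !mulf_eq0 !negb_or.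
  move=> /andP[/andP[d1 d2] d3].
  have fs y : on_cone F (P s^-1 y) -> h.@[(n + s *: T + (s * y) *: m) 0] != 0 ->
      f (P s^-1 y) - ka = (b a h).@[(n + s *: T + (s * y) *: m) 0] /
        h.@[(n + s *: T + (s * y) *: m) 0].
    by rewrite -scale_P // => Yy hy; rewrite -(f_hom s) // (fbE a h) // on_coneZ.
  by rewrite /phi !fs // -!mulf_div.
have := rational_constant phi_rat D0 phi_inf x0.
have f0 y : f (n + 0 *: T + y *: m) = f m by rewrite scale0r addr0 f_line.
rewrite (DE _ _ r'P) (NE _ _ r'P) -!mulf_div -!(fbE a h) // !f0.
have /eqP : (y0 - (r x0).1.1) * (y0 - (r x0).1.2) * (y0 - (r x0).2) = 0.
  rewrite (root_eq _ _ _ _ _ (rP x0)); apply: (mulfI k_neq0); rewrite mulr0.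
  have := section_TF 1 x0 y0; rewrite scale1r (eqP Fp) => ->.
  by rewrite /c1 /c0 !hornerE /=; ring.
have faE : f (P x0 y0) - ka = 0 by rewrite subrr.
rewrite !mulf_eq0 !subr_eq0 => y0E phi0.
have : (f m - ka) * (f m - ka) * (f m - ka) = 0.
  rewrite -phi0 /phi.
  by case/orP: y0E => [/orP[]|] /eqP <-; rewrite faE !(mul0r, mulr0).
by move/eqP; rewrite !mulf_eq0 !orbb subr_eq0 eq_sym (negPf fp0_neq).
Qed.
End PlaneCubic.

(** * Regular 2-forms *)

Section RegularTwoForms.
Variables (K : numClosedFieldType) (F : {mpoly K[4]}).
Hypothesis smF : smooth_quartic F.
Implicit Types (n p u v x y : 'rV[K]_4) (w : 'rV[K]_4 -> 'rV[K]_4 -> 'rV[K]_4 -> K).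

Let homF : F \is 4.-homog := proj1 smF.

(** In the bilinear expansion the terms with [p] vanish, and the others are those
of a determinant of size 2. *)
Lemma alternating_form_det (g : 'rV[K]_4 -> 'rV[K]_4 -> K) p U V a b c a' b' c' :
  (forall a b x y z, g (a *: x + b *: y) z = a * g x z + b * g y z) ->
  (forall a b x y z, g z (a *: x + b *: y) = a * g z x + b * g z y) ->
  (forall a b c, let x := a *: p + 1 *: (b *: U + c *: V) in g x x = 0) ->
  (forall b c, g p (b *: U + c *: V) = 0) ->
  g (a *: p + 1 *: (b *: U + c *: V)) (a' *: p + 1 *: (b' *: U + c' *: V)) =
  (b * c' - c * b') * g U V.
Proof.
move=> gl gr galt gp.
have gpU : g p U = 0 by have := gp 1 0; rewrite gr mul0r addr0 mul1r.
have gpV : g p V = 0 by have := gp 0 1; rewrite gr mul0r add0r mul1r.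
have gpp : g p p = 0.
  by have := galt 1 0 0; rewrite /= !(gl, gr) !(mul0r, mul1r, addr0, add0r, mulr0).
have gUU : g U U = 0.
  by have := galt 0 1 0; rewrite /= !(gl, gr) !(mul0r, mul1r, addr0, add0r, mulr0).
have gVV : g V V = 0.
  by have := galt 0 0 1; rewrite /= !(gl, gr) !(mul0r, mul1r, addr0, add0r, mulr0).
have gUp : g U p = 0.
  have := galt 1 1 0; rewrite /= !(gl, gr) !(mul0r, mul1r, addr0, add0r, mulr0).
  by rewrite gpp gUU gpU !(addr0, add0r).
have gVp : g V p = 0.
  have := galt 1 0 1; rewrite /= !(gl, gr) !(mul0r, mul1r, addr0, add0r, mulr0).
  by rewrite gpp gVV gpV !(addr0, add0r).
have gVU : g V U = - g U V.
  have := galt 0 1 1; rewrite /= !(gl, gr) !(mul0r, mul1r, addr0, add0r, mulr0).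
  by rewrite gUU gVV addr0 add0r => /eqP; rewrite addr_eq0 => /eqP ->; rewrite opprK.
by rewrite !(gl, gr) gpp gpU gpV gUp gVp gUU gVV gVU; ring.
Qed.

Lemma tangent_basis n p u0 v0 x : on_cone F p ->
  dform F p n != 0 -> vol n p u0 v0 != 0 -> cone_tangent F p x ->
  exists a b c, x = a *: p + 1 *: (b *: tangent_part F p n u0
                                  + c *: tangent_part F p n v0).
Proof.
move=> /andP[_ Fp] dn vol0 Tx.
have [d [a [b [c xE]]]] := vol_basis x vol0.
exists a, (b / dform F p n), (c / dform F p n).
have dx : d * dform F p n + (b * dform F p u0 + c * dform F p v0) = 0.
  have : dform F p x == 0 by [].
  rewrite xE -[d *: n + _]scale1r -[b *: u0 + _]scale1r !dform_linear.
  by rewrite (dform_radial homF Fp) mulr0 addr0 !mul1r => /eqP.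
have dE : d = - (b / dform F p n * dform F p u0 + c / dform F p n * dform F p v0).
  apply: (mulIf dn); rewrite -[LHS]subr0 -dx; field.
  exact: dn.
rewrite xE {1}dE /tangent_part scale1r !scalerDr !scalerA !divfK // !mulrN.
rewrite scaleNr scalerDl !scaleNr opprD.
by apply/rowP => i; rewrite !mxE; ring.
Qed.

(** The tangent plane of the surface is two-dimensional, so that its alternating
forms are proportional to the residue. *)
Lemma regular_2form_pointwise w p : regular_2form F w -> on_cone F p ->
  exists k, forall u v, cone_tangent F p u -> cone_tangent F p v ->
    w p u v = k * residue F p u v.
Proof.
move=> [w_alt w_p _ w_loc] Yp; have /andP[_ Fp] := Yp.
have [B [h [hp wE]]] := w_loc p Yp.
have [n [u0 [v0 [dn vol0]]]] := transverse_frame smF Yp.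
pose U := tangent_part F p n u0; pose V := tangent_part F p n v0.
have TU : cone_tangent F p U by apply: cone_tangent_part.
have TV : cone_tangent F p V by apply: cone_tangent_part.
have Tp : cone_tangent F p p by rewrite cone_tangentE dform_radial.
have Tlin a b x y : cone_tangent F p x -> cone_tangent F p y ->
    cone_tangent F p (a *: x + b *: y).
  rewrite !cone_tangentE dform_linear => /eqP -> /eqP ->.
  by rewrite !mulr0 addr0.
pose g x y := (\sum_(i < 4) \sum_(j < 4) (B i j).@[p 0] * x 0 i * y 0 j) / h.@[p 0].
have gl a b x y z : g (a *: x + b *: y) z = a * g x z + b * g y z.
  rewrite /g !mulrA -mulrDl; congr (_ / _); rewrite !mulr_sumr -big_split.
  apply: eq_bigr => i _ /=; rewrite !mulr_sumr -big_split; apply: eq_bigr => j _ /=.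
  by rewrite !mxE; ring.
have gr a b x y z : g z (a *: x + b *: y) = a * g z x + b * g z y.
  rewrite /g !mulrA -mulrDl; congr (_ / _); rewrite !mulr_sumr -big_split.
  apply: eq_bigr => i _ /=; rewrite !mulr_sumr -big_split; apply: eq_bigr => j _ /=.
  by rewrite !mxE; ring.
have wg u v : cone_tangent F p u -> cone_tangent F p v -> w p u v = g u v.
  by move=> Tu Tv; rewrite /g wE.
have volU : vol n p U V != 0.
  by rewrite vol_tangent_part mulf_neq0 ?expf_neq0.
exists (g U V * dform F p n / vol n p U V) => u v Tu Tv.
rewrite wg // (residueE (n := n)) //.
have [a [b [c uE]]] := tangent_basis Yp dn vol0 Tu.
have [a' [b' [c' vE]]] := tangent_basis Yp dn vol0 Tv.
have gE : g u v = (b * c' - c * b') * g U V.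
  rewrite uE vE; apply: alternating_form_det => // [a1 b1 c1 x|b1 c1].
    have Tx : cone_tangent F p x by apply: (Tlin) => //; apply: Tlin.
    by rewrite -wg // w_alt.
  have Tx : cone_tangent F p (b1 *: U + c1 *: V) by apply: Tlin.
  by rewrite -wg // w_p.
have volE : vol n p u v = (b * c' - c * b') * vol n p U V.
  rewrite uE vE; apply: (alternating_form_det (g := fun x y => vol n p x y)).
  - by move=> *; apply: vol_linear_u.
  - by move=> *; apply: vol_linear_v.
  - by move=> *; apply: vol_alt_uv.
  - by move=> *; rewrite vol_alt_pu.
rewrite gE volE; field.
by rewrite dn.
Qed.

Lemma residueZ c p u v : c != 0 -> on_cone F p ->
  cone_tangent F p u -> cone_tangent F p v ->
  residue F (c *: p) (c *: u) (c *: v) = residue F p u v.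
Proof.
move=> c0 Yp Tu Tv; have [_ _ /(_ c p u v c0 Yp Tu Tv)] := regular_tangent_residue smF.
by rewrite /tangent_residue !cone_tangentZ // Tu Tv.
Qed.

(** The quotient of a regular 2-form by the residue is computed near each point
on a frame of tangent vectors with polynomial coefficients. *)
Lemma regular_2form_multiple w : regular_2form F w ->
  exists2 f, regular_function F f & forall p u v, on_cone F p ->
    cone_tangent F p u -> cone_tangent F p v -> w p u v = f p * residue F p u v.
Proof.
move=> w_reg; have [_ _ w_scale w_loc] := w_reg.
have /boolp.choice[f fE] : forall p, exists k, on_cone F p -> forall u v,
    cone_tangent F p u -> cone_tangent F p v -> w p u v = k * residue F p u v.
  move=> p; case Yp: (on_cone F p); last by exists 0.
  by have [k kE] := regular_2form_pointwise w_reg Yp; exists k => _; apply: kE.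
exists f => [|p u v Yp]; last exact: fE.
have frame p n u0 v0 : on_cone F p -> dform F p n != 0 ->
    residue F p (tangent_part F p n u0) (tangent_part F p n v0) =
    dform F p n * vol n p u0 v0.
  move=> Yp dn; have /andP[_ Fp] := Yp.
  rewrite (residueE (n := n)) ?cone_tangent_part // vol_tangent_part.
  by rewrite mulrAC expr2 mulfK.
split=> [c p c0 Yp|p0 Yp0].
  have [n [u0 [v0 [dn vol0]]]] := transverse_frame smF Yp.
  have TU := cone_tangent_part F p n u0; have TV := cone_tangent_part F p n v0.
  have res0 : residue F p (tangent_part F p n u0) (tangent_part F p n v0) != 0.
    by rewrite frame // mulf_neq0.
  apply: (mulIf res0); rewrite -fE // -{1}(residueZ c0) //.
  by rewrite -fE ?on_coneZ ?cone_tangentZ // w_scale.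
have [n [u0 [v0 [dn vol0]]]] := transverse_frame smF Yp0.
have [B [h [hp0 wE]]] := w_loc p0 Yp0.
pose dP x : {mpoly K[4]} := \sum_(i < 4) x 0 i *: F^`M(i).
have dPE x p : (dP x).@[p 0] = dform F p x.
  by rewrite raddf_sum; apply: eq_bigr => i _ /=; rewrite mevalZ mulrC.
pose tP x (i : 'I_4) : {mpoly K[4]} := x 0 i *: dP n - n 0 i *: dP x.
have tPE x i p : (tP x i).@[p 0] = tangent_part F p n x 0 i.
  by rewrite mevalB !mevalZ !dPE !mxE; ring.
pose vP : {mpoly K[4]} := \sum_(l < 4) vol n (delta_mx 0 l) u0 v0 *: 'X_l.
have vPE p : vP.@[p 0] = vol n p u0 v0.
  rewrite (linear_sum_delta p (fun a b x y => vol_linear_p a b n x y u0 v0)).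
  by rewrite raddf_sum; apply: eq_bigr => l _ /=; rewrite mevalZ mevalXU mulrC.
exists (\sum_(i < 4) \sum_(j < 4) B i j * tP u0 i * tP v0 j), (h * (dP n * vP)).
split=> [|p Yp]; first by rewrite !mevalM dPE vPE !mulf_neq0.
rewrite !mevalM dPE vPE !mulf_eq0 !negb_or => /and3P[hp dnp volp].
have TU := cone_tangent_part F p n u0; have TV := cone_tangent_part F p n v0.
have := wE p _ _ Yp hp TU TV; rewrite fE // frame // => fpE.
apply: (mulIf (mulf_neq0 dnp volp)); rewrite fpE invfM [X in _ = X * _]mulrA divfK ?mulf_neq0 //.
congr (_ / _); rewrite raddf_sum; apply: eq_bigr => i _.
rewrite raddf_sum; apply: eq_bigr => j _ /=.
by rewrite !mevalM !tPE.
Qed.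

End RegularTwoForms.

(** * From the special form to a symmetry *)

Section SpecialSymmetry.
Variables (K : numClosedFieldType) (F : {mpoly K[4]}) (L : 'M[K]_(2, 4)).
Hypothesis smF : smooth_quartic F.
Variables (M : 'M[K]_4) (q g : {mpoly K[2]}) (c : K).
Hypotheses (Mu : M \in unitmx) (homq : q \is 2.-homog) (homg : g \is 4.-homog).
Hypothesis c_neq0 : c != 0.
Hypothesis LE : forall p : 'rV[K]_4, (p <= L)%MS =
  ((p *m M) 0 (inord 0) == 0) && ((p *m M) 0 (inord 1) == 0).
Hypothesis FE : F = c *: special_form (linear_coordinate M) q g.
Implicit Types (p u v : 'rV[K]_4).

Let homF : F \is 4.-homog := proj1 smF.

Definition coordinate_point (x0 x1 x2 x3 : K) : 'rV[K]_4 :=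
  (\row_(i < 4) tnth [tuple x0; x1; x2; x3] i) *m invmx M.

Lemma coordinate_pointK x0 x1 x2 x3 (j : 'I_4) :
  (coordinate_point x0 x1 x2 x3 *m M) 0 j = tnth [tuple x0; x1; x2; x3] j.
Proof. by rewrite mulmxKV // mxE. Qed.

Lemma coordinate_pointE p : p = coordinate_point ((p *m M) 0 (inord 0))
  ((p *m M) 0 (inord 1)) ((p *m M) 0 (inord 2)) ((p *m M) 0 (inord 3)).
Proof.
rewrite -{1}[p](mulmxK Mu); congr (_ *m _); apply/rowP => i; rewrite [RHS]mxE (tnth_nth 0).
by case: i => [[|[|[|[|//]]]] ?] /=; congr ((p *m M) 0 _); apply: val_inj; rewrite /= inordK.
Qed.

Lemma coordinate_point_linear a b x0 x1 x2 x3 y0 y1 y2 y3 :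
  a *: coordinate_point x0 x1 x2 x3 + b *: coordinate_point y0 y1 y2 y3 =
  coordinate_point (a * x0 + b * y0) (a * x1 + b * y1) (a * x2 + b * y2)
    (a * x3 + b * y3).
Proof.
rewrite !scalemxAl -mulmxDl; congr (_ *m _); apply/rowP => i; rewrite !mxE !(tnth_nth 0).
by case: i => [[|[|[|[|//]]]] ?].
Qed.

Lemma coordinate_point_eq0 x0 x1 x2 x3 :
  coordinate_point x0 x1 x2 x3 = 0 -> [/\ x0 = 0, x1 = 0, x2 = 0 & x3 = 0].
Proof.
move=> E; have x (j : 'I_4) : tnth [tuple x0; x1; x2; x3] j = 0.
  by rewrite -coordinate_pointK E mul0mx mxE.
by have := (x (inord 0), x (inord 1), x (inord 2), x (inord 3));
  rewrite !(tnth_nth 0) !inordK //= => -[[[-> ->] ->] ->].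
Qed.

Lemma special_eval x0 x1 x2 x3 : F.@[coordinate_point x0 x1 x2 x3 0] =
  c * (x0 * x3 ^+ 3 + x1 * x2 ^+ 3 + x2 * x3 * q.@[point2 x0 x1]
       + g.@[point2 x0 x1]).
Proof.
rewrite FE mevalZ special_form_eval !coordinate_pointK !(tnth_nth 0).
by rewrite !inordK.
Qed.

Lemma special_eval_line x2 x3 : F.@[coordinate_point 0 0 x2 x3 0] = 0.
Proof.
rewrite special_eval; have := dhomog_eval2 0 0 0 homq; rewrite mul0r => ->.
have := dhomog_eval2 0 0 0 homg; rewrite mul0r => ->.
by rewrite !expr0n !(mul0r, mulr0, addr0).
Qed.

Lemma line_on_special x2 x3 : (x2 != 0) || (x3 != 0) ->
  on_cone F (coordinate_point 0 0 x2 x3).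
Proof.
move=> x23; rewrite /on_cone /on_surface special_eval_line eqxx andbT.
by apply: contraTneq x23 => /coordinate_point_eq0[_ _ -> ->]; rewrite eqxx.
Qed.

(** Every point lies in a plane through the line, so it is on the line or on a
plane cubic to which [plane_cubic_constant] applies. The point from which the
cubic is projected must not lie on it; this holds for [b3] or for [b2], according
to which of the first two coordinates is nonzero. *)
Lemma special_regular_function_constant f : regular_function F f ->
  forall p, on_cone F p -> f p = f (coordinate_point 0 0 0 1).
Proof.
move=> f_reg p Yp; have [f_hom _] := f_reg.
pose b2 := coordinate_point 0 0 1 0; pose b3 := coordinate_point 0 0 0 1.
have f_line t : f (b2 + t *: b3) = f b3.
  apply: (regular_function_line f_reg) => x y; rewrite coordinate_point_linear.
    by rewrite !(mulr0, mulr1, addr0, add0r) special_eval_line.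
  by move/coordinate_point_eq0; rewrite !(mulr0, mulr1, addr0, add0r) => -[].
have f23 : f b2 = f b3 by have := f_line 0; rewrite scale0r addr0.
have := Yp; rewrite [p]coordinate_pointE.
set x0 := (p *m M) 0 (inord 0); set x1 := (p *m M) 0 (inord 1).
set x2 := (p *m M) 0 (inord 2); set x3 := (p *m M) 0 (inord 3) => Yx.
pose T := coordinate_point x0 x1 0 0.
have combE s x y : s *: T + x *: b2 + y *: b3 = coordinate_point (s * x0) (s * x1) x y.
  rewrite coordinate_point_linear -[coordinate_point _ _ _ _ in LHS]scale1r.
  rewrite coordinate_point_linear.
  by congr (coordinate_point _ _ _ _); ring.
have sectionE s x y : F.@[(s *: T + x *: b2 + y *: b3) 0] =
    s * c * (x0 * y ^+ 3 + x1 * x ^+ 3 + q.@[point2 x0 x1] * s * x * y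
             + g.@[point2 x0 x1] * s ^+ 3).
  rewrite combE special_eval (dhomog_eval2 _ _ _ homq) (dhomog_eval2 _ _ _ homg).
  ring.
have pE : coordinate_point x0 x1 x2 x3 = T + x2 *: b2 + x3 *: b3.
  by rewrite -[T]scale1r combE !mul1r.
have /andP[_ Fx] := Yx; rewrite pE in Fx *.
have [x0_0|x0_neq0] := eqVneq x0 0; last first.
  apply: (@plane_cubic_constant _ F f T b2 b3 (c * x0) (q.@[point2 x0 x1] / x0)
    (x1 / x0) (g.@[point2 x0 x1] / x0)) => // [|s x y|s x y].
  - by rewrite mulf_neq0.
  - by rewrite sectionE; field.
  rewrite combE => /coordinate_point_eq0[/eqP + _ -> ->].
  by rewrite mulf_eq0 (negPf x0_neq0) orbF => /eqP ->.
have [x1_0|x1_neq0] := eqVneq x1 0; last first.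
  rewrite addrAC in Fx *; rewrite -/b3 -f23.
  apply: (@plane_cubic_constant _ F f T b3 b2 (c * x1) (q.@[point2 x0 x1] / x1)
    (x0 / x1) (g.@[point2 x0 x1] / x1)) => // [|s x y|s x y].
  - by rewrite mulf_neq0.
  - by rewrite addrAC sectionE; field.
  rewrite addrAC combE => /coordinate_point_eq0[_ /eqP + -> ->].
  by rewrite mulf_eq0 (negPf x1_neq0) orbF => /eqP ->.
have T0 : T = 0.
  rewrite /T x0_0 x1_0 /coordinate_point (_ : \row_(i < 4) _ = 0) ?mul0mx //.
  by apply/rowP => i; rewrite !mxE (tnth_nth 0); case: i => [[|[|[|[|//]]]] ?].
rewrite T0 add0r; have [x2_0|x2_neq0] := eqVneq x2 0.
  rewrite x2_0 scale0r add0r f_hom //.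
    apply: contraTneq Yx => x3_0.
    by rewrite pE T0 x2_0 x3_0 !scale0r !addr0 /on_cone eqxx.
  by apply: line_on_special; rewrite oner_eq0 orbT.
rewrite -/b3 -(f_line (x3 / x2)) -(f_hom x2 (b2 + (x3 / x2) *: b3)) //.
  by rewrite scalerDr scalerA mulrCA divff // mulr1.
rewrite -[b2]scale1r coordinate_point_linear !(mulr0, mulr1, addr0, add0r).
by apply: line_on_special; rewrite oner_eq0.
Qed.

(** The symmetry is the diagonal matrix with entries 1, 1, [z], [z ^+ 2] in the
coordinates of the special form. The regular 2-forms are constant multiples of
the residue, which it preserves because it has determinant 1 and preserves the
equation. *)
Lemma special_symmetry : \rank L = 2%N -> exists A : 'M[K]_4,
  [/\ symmetry F A, symplectic F A, symmetry_order F A 3%N &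
      preserves_planes_through L A].
Proof.
move=> rL; have [z zE] := cube_root_of_unity K.
have [z3 z1] := cube_root_of_unityP zE.
pose D : 'M[K]_4 := diag_mx (\row_i tnth [tuple 1; 1; z; z ^+ 2] i).
have detD : \det D = 1.
  rewrite det_diag !big_ord_recl big_ord0 !mxE !(tnth_nth 0) /=.
  by rewrite -[RHS]z3; ring.
pose A := M *m D *m invmx M.
have detA : \det A = 1.
  by rewrite !det_mulmx detD mulr1 -det_mulmx mulmxV // det1.
have Au : A \in unitmx by rewrite unitmxE detA unitr1.
have AE x0 x1 x2 x3 : coordinate_point x0 x1 x2 x3 *m A =
    coordinate_point x0 x1 (z * x2) (z ^+ 2 * x3).
  rewrite /A !mulmxA mulmxKV //; congr (_ *m _); apply/rowP => i.
  rewrite mul_mx_diag !mxE !(tnth_nth 0).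
  by case: i => [[|[|[|[|//]]]] ?] /=; rewrite ?mulr1 // mulrC.
have FA p : F.@[(p *m A) 0] = F.@[p 0].
  rewrite [p]coordinate_pointE; set x0 := _ 0 (inord 0); set x1 := _ 0 (inord 1).
  set x2 := _ 0 (inord 2); set x3 := _ 0 (inord 3); rewrite AE !special_eval.
  have w3 : (z ^+ 3 - 1) * (c * ((z ^+ 3 + 1) * x0 * x3 ^+ 3 + x1 * x2 ^+ 3
      + x2 * x3 * q.@[point2 x0 x1])) = 0 by rewrite z3 subrr mul0r.
  by rewrite -[RHS]addr0 -w3; ring.
have symA : symmetry F A by split=> // p; rewrite /on_surface FA.
exists A; split=> //.
- move=> w w_reg p u v Yp Tu Tv.
  have [f f_reg fE] := regular_2form_multiple smF w_reg.
  have YpA : on_cone F (p *m A).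
    have /andP[p0 Fp] := Yp; rewrite /on_cone /on_surface FA -/(on_surface F p) Fp andbT.
    by apply: contra_neq p0 => pA0; rewrite -[p](mulmxK Au) pA0 mul0mx.
  have TA x : cone_tangent F p x -> cone_tangent F (p *m A) (x *m A).
    by rewrite !cone_tangentE dform_invariant.
  rewrite !fE ?TA // !(special_regular_function_constant f_reg) //; congr (_ * _).
  have /andP[_ Fp] := Yp; have /andP[_ FpA] := YpA.
  have [n dn] := smooth_dform smF Yp.
  rewrite (residueE (n := n *m A)) ?TA ?dform_invariant // vol_mulmx detA mulr1.
  by rewrite -residueE.
- have A2E x0 x1 x2 x3 m : coordinate_point x0 x1 x2 x3 *m A ^+ m =
      coordinate_point x0 x1 (z ^+ m * x2) (z ^+ (2 * m) * x3).
    elim: m => [|m IHm]; first by rewrite muln0 !expr0 !mul1r mulmx1.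
    rewrite exprSr -mulmxE mulmxA IHm AE; congr (coordinate_point _ _ _ _).
      by rewrite mulrA -exprS.
    by rewrite mulrA -exprD mulnS.
  split=> // [p _|m /andP[m_gt0 m_lt3] trivm].
    rewrite [p]coordinate_pointE A2E z3 mulnC exprM z3 expr1n !mul1r.
    by rewrite submx_refl.
  have z0 : z != 0 by apply: contra_eq_neq z3 => ->; rewrite expr0n eq_sym oner_eq0.
  pose r := coordinate_point 0 0 1 1.
  have r0 : r != 0.
    by apply/eqP => /coordinate_point_eq0[_ _ /eqP]; rewrite oner_eq0.
  have rL' : (r <= L)%MS by rewrite LE !coordinate_pointK !(tnth_nth 0) !inordK //= eqxx.
  have Yr : on_cone F r by apply: line_on_special; rewrite oner_eq0.
  have /andP[/sub_rVP[a ra] _] := trivm r Yr.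
  have zm1 : z ^+ m = 1.
    have e2 := congr1 (fun x => (x *m M) 0 (inord 2)) ra.
    have e3 := congr1 (fun x => (x *m M) 0 (inord 3)) ra.
    have scaleE j : (a *: r *m M) 0 j = a * (r *m M) 0 j.
      by rewrite -scalemxAl mxE.
    move: e2 e3; rewrite !scaleE /r !A2E !coordinate_pointK !(tnth_nth 0).
    rewrite !inordK //= !mulr1 => <-.
    rewrite mul2n -addnn exprD => /(congr1 (fun x => x / z ^+ m)).
    by rewrite mulfK ?divff // expf_neq0.
  have zm : z ^+ (3 - m) = 1.
    by apply: (mulfI (expf_neq0 m z0)); rewrite -exprD subnKC ?(ltnW m_lt3) // z3 zm1 mulr1.
  case/eqP: z1; case: m m_gt0 m_lt3 zm1 zm {trivm ra} => [|[|[|//]]] // _ _.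
move=> P rP LP; rewrite -(geq_leqif (mxrank_leqif_eq _)); last first.
  apply/row_subP => i; rewrite row_mul -[_ *m A](subrK (row i P)).
  rewrite addmx_sub ?row_sub //; apply: submx_trans LP.
  rewrite [row i P]coordinate_pointE AE -[X in X - _]scale1r -scaleN1r.
  rewrite coordinate_point_linear LE !coordinate_pointK !(tnth_nth 0) !inordK //=.
  by rewrite !mul1r !mulN1r !subrr eqxx.
by rewrite mxrankMfree ?row_free_unit.
Qed.
End SpecialSymmetry.

Theorem proposition4p6 (R : realType) (F : {mpoly R[i][4]})
    (L : 'M[R[i]]_(2, 4)) :
  smooth_quartic F -> line_on_surface F L ->
  (special_line F L <->
   exists A : 'M[R[i]]_4,
     [/\ symmetry F A, symplectic F A, symmetry_order F A 3%N &
         preserves_planes_through L A]).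
Proof.
move=> smF lineL; split.
  move=> [M [q [g [c [[Mu homq homg c_neq0] [LE FE]]]]]].
  exact: (special_symmetry smF Mu homq homg c_neq0 LE FE (proj1 lineL)).
move=> [A [symA sympA ordA planesA]].
have [B [[Bu BL dB SB] [B3 B1]]] :=
  normalized_symmetry smF lineL symA sympA ordA planesA.
have [v2 [v3 [z [[v2L v3L v3_neq0 v23] [eigB detB]]]]] :=
  line_eigenvalues smF lineL Bu BL dB B3 B1.
have [Bv2 Bv3 z3 z1] := eigB.
have [e0 [e1 [fixB dualE]]] :=
  fixed_dual_basis smF lineL BL dB v2L v3L v3_neq0 v23 z3 z1 Bv2 Bv3 detB.
have spanL := line_span (proj1 lineL) v2L v3L v3_neq0 v23.
exact: (special_of_normal_form smF lineL spanL fixB eigB dualE SB).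
Qed.
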